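(* Suppose the self-similar measure $\mu$ on $\mathbb{R}$ has support $[0,1]$ and satisfies the asymptotic gap weak separation condition. Then $\dim_{qA}\mu<\infty$ if and only if $\mu$ is quasi-net doubling.
   Context: $B(x,r)$ denotes the ball of centre $x$ and radius $r$. Self-similar measures. An iterated function system (IFS) is a finite family $\{S_j\}_{j=0}^{m-1}$ of maps $S_j(x)=r_jx+d_j$ on $\mathbb{R}$ with $0<r_j<1$, $d_j\in\mathbb{R}$. Its attractor is the unique non-empty compact set $F$ with $F=\bigcup_j S_j(F)$; here $F=[0,1]$, and the maps are labelled so that $S_0(0)=0$ and $S_{m-1}(1)=1$. Given probabilities $p_j>0$, $\sum_j p_j=1$, the associated self-similar measure $\mu$ is the unique Borel probability measure with $\mu(E)=\sum_j p_j\mu(S_j^{-1}(E))$ for all Borel sets $E$; its support is $[0,1]$. Put $\lambda=\min_j r_j$. For a finite word $w=w_1\cdots w_n$ put $S_w=S_{w_1}\circ\cdots\circ S_{w_n}$, $r_w=r_{w_1}\cdots r_{w_n}$, $w^-=w_1\cdots w_{n-1}$. For $n\ge 1$, $\Lambda_n$ is the set of finite words $u$ with $r_u\leq\lambda^n$ and $r_{u^-}>\lambda^n$. Asymptotic gap weak separation condition (AGWSC) with function $f$. There is a non-increasing function $f(n)>0$ with $(\log f(n))/n\to0$ as $n\to\infty$ such that for all $n$, all $u,w\in\Lambda_n$ and each $z\in\{0,1\}$: if $S_u(z)\neq S_w(z)$ then $|S_u(z)-S_w(z)|\geq f(n)\lambda^n$. It is assumed, without loss of generality, that $f(n)<\lambda$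 for all $n$. A self-similar measure satisfies the AGWSC if its underlying IFS does. Net intervals. For $n\ge1$ let $h_1<\dots<h_{s_n}$ be the elements of $\{S_u(0),S_u(1):u\in\Lambda_n\}$; the net intervals of level $n$ are $[h_j,h_{j+1}]$, $1\le j\le s_n-1$; $[0,1]$ is the unique net interval of level $0$. $l(\Delta)$ is the length of $\Delta$; $\Delta_n(0)$ and $\Delta_n(1)$ are the net intervals of level $n$ containing $0$ and $1$. For a level $n$ net interval $\Delta_n\neq\Delta_n(0),\Delta_n(1)$, $\Delta_n^R$ is the union of the two level $n$ net intervals immediately to the right of $\Delta_n$ and $\Delta_n^L$ the union of the two immediately to the left, with the understanding that $\Delta_n^R=\Delta_n(1)$ if $\Delta_n$ is immediately adjacent to $\Delta_n(1)$, and $\Delta_n^L=\Delta_n(0)$ if $\Delta_n$ is immediately adjacent to $\Delta_n(0)$. If $\Delta_n=\Delta_n(1)$ only $\Delta_n^L$ is defined, and if $\Delta_n=\Delta_n(0)$ only $\Delta_n^R$ is defined. Quasi-net doubling. A self-similar measure $\mu$ satisfying the AGWSC with function $f$ is quasi-net doubling if for every $q>1$ there exist $c_1,c_2>0$ such that for every level $n$ net interval $\Delta_n$ with $l(\Delta_n)\geq f(n+1)\lambda^{n+1}$, $$c_1q^{-n}\mu(\Delta_n^* )\leq\mu(\Delta_n)\leq c_2q^n\mu(\Delta_n^* )$$ for $\Delta_n^*=\Delta_n^L$ and $\Delta_n^*=\Delta_n^R$, where defined. Quasi-Assouad dimension. For $\delta\ge0$ let $H(\delta)$ be the infimum of all $s$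 for which there exist $C_1,C_2>0$ such that for all $0<r\leq R^{1+\delta}\leq R\leq C_1$, $\sup_{x\in\operatorname{supp}\mu}\frac{\mu(B(x,R))}{\mu(B(x,r))}\leq C_2(R/r)^s$. Then $\dim_{qA}\mu=\lim_{\delta\to0}H(\delta)$. *)

(* Defs.v *)
From HB Require Import structures.
From mathcomp Require Import all_boot all_order all_algebra.
From mathcomp Require Import all_classical all_reals all_analysis.

Set Implicit Arguments.
Unset Strict Implicit.
Unset Printing Implicit Defensive.

Import Order.TTheory GRing.Theory Num.Theory.
Import numFieldNormedType.Exports.

Local Open Scope classical_set_scope.
Local Open Scope ring_scope.

Record ifs (R : realType) (m : nat) := IFS {
  ratio : 'I_m -> R;
  shift : 'I_m -> R;
  ratio_gt0 : forall j, 0 < ratio j;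
  ratio_lt1 : forall j, ratio j < 1 }.

Section IteratedFunctionSystem.
Context {R : realType} {m : nat} (S : ifs R m).

Definition ifs_map (j : 'I_m) (x : R) : R := ratio S j * x + shift S j.

Definition is_attractor (F : set R) : Prop :=
  [/\ F !=set0, compact F & F = \bigcup_j (ifs_map j @` F)].

(* The default value 1 of the iterated minimum is harmless when 0 < m, since
   every ratio is < 1. *)
Definition min_ratio : R := \big[Num.min/1]_(j < m) ratio S j.

Definition word_map (w : seq 'I_m) : R -> R :=
  foldr (fun j g => ifs_map j \o g) id w.

Definition word_ratio (w : seq 'I_m) : R := \prod_(j <- w) ratio S j.

Definition word_parent (w : seq 'I_m) : seq 'I_m := take (size w).-1 w.

(* $\Lambda_n$, meaningful for 0 < n; its words are then nonempty. *)
Definition level_words (n : nat) : set (seq 'I_m) :=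
  [set u | word_ratio u <= min_ratio ^+ n /\
           min_ratio ^+ n < word_ratio (word_parent u)].

(* f is only constrained, and below only used, at positive integers. *)
Definition agwsc (f : nat -> R) : Prop :=
  [/\ forall n, (0 < n)%N -> 0 < f n,
      forall n k, (0 < n)%N -> (n <= k)%N -> f k <= f n,
      (fun n => ln (f n) / n%:R) @ \oo --> (0 : R)
    & forall n u w (z : R), (0 < n)%N ->
        level_words n u -> level_words n w -> z = 0 \/ z = 1 ->
        word_map u z != word_map w z ->
        f n * min_ratio ^+ n <= `|word_map u z - word_map w z| ].

Definition net_points (n : nat) : set R :=
  if n is 0%N then [set 0; 1]
  else [set x | exists2 u, level_words n u &
                  x = word_map u 0 \/ x = word_map u 1].

(* `[a, b] is a net interval of level n, that is, a and b are consecutive in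
   the increasing enumeration of the finite set net_points n. *)
Definition net_interval (n : nat) (a b : R) : Prop :=
  [/\ net_points n a, net_points n b, a < b
    & forall x, net_points n x -> ~ (a < x < b)].

(* D is $\Delta^R$ for a net interval $\Delta$ of level n with right endpoint
   b. The net interval of level n containing 1 is the one whose right endpoint
   is 1. No D qualifies when b = 1. *)
Definition net_right (n : nat) (b : R) (D : set R) : Prop :=
  exists2 c, net_interval n b c &
    (c = 1 /\ D = `[b, c]%classic) \/
    (exists2 d, net_interval n c d & D = `[b, c] `|` `[c, d]).

(* Mirror image: $\Delta^L$ for $\Delta$ with left endpoint a. *)
Definition net_left (n : nat) (a : R) (D : set R) : Prop :=
  exists2 c, net_interval n c a &
    (c = 0 /\ D = `[c, a]%classic) \/
    (exists2 d, net_interval n d c & D = `[d, c] `|` `[c, a]).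

Definition quasi_net_doubling (f : nat -> R)
    (mu : probability (measurableTypeR R) R) : Prop :=
  forall q : R, 1 < q -> exists c1 c2 : R, [/\ 0 < c1, 0 < c2 &
    forall n a b (D : set R), net_interval n a b ->
      f n.+1 * min_ratio ^+ n.+1 <= b - a ->
      net_left n a D \/ net_right n b D ->
      ((c1 * q ^- n)%:E * mu D <= mu `[a, b]%classic)%E /\
      (mu `[a, b]%classic <= (c2 * q ^+ n)%:E * mu D)%E].

Definition self_similar (p : 'I_m -> R)
    (mu : probability (measurableTypeR R) R) : Prop :=
  forall E : set (measurableTypeR R), measurable E ->
    mu E = (\sum_(j < m) (p j)%:E * mu (ifs_map j @^-1` E))%E.

End IteratedFunctionSystem.

Section QuasiAssouad.
Context {R : realType} (mu : probability (measurableTypeR R) R).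

Definition measure_support : set R :=
  [set x | forall r : R, 0 < r -> (0 < mu (ball x r))%E].

(* The exponents s admissible in the definition of $H(\delta)$. The quotient
   is one of real numbers, with nonzero denominator on the support. *)
Definition qA_exponent (delta s : R) : Prop :=
  exists C1 C2 : R, [/\ 0 < C1, 0 < C2 &
    forall r rho : R, 0 < r -> 0 < rho ->
      r <= rho `^ (1 + delta) -> rho `^ (1 + delta) <= rho -> rho <= C1 ->
      (ereal_sup [set (fine (mu (ball x rho)) / fine (mu (ball x r)))%:E
                 | x in measure_support]
        <= (C2 * (rho / r) `^ s)%:E)%E].

(* Equal to +oo when there is no admissible exponent. *)
Definition qA_H (delta : R) : \bar R :=
  ereal_inf [set s%:E | s in qA_exponent delta].

(* qA_H is nonincreasing on positive reals, so the one-sided limit exists in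
   the extended reals. *)
Definition qA_dim : \bar R := lim (qA_H delta @[delta --> 0^'+]).

End QuasiAssouad.

(* Main.v *)
From mathcomp Require Import all_boot all_order all_algebra.
From mathcomp Require Import all_classical all_reals all_analysis.
From mathcomp Require Import measurable_realfun.
From mathcomp Require Import ring lra.
Require Import Defs.

Set Implicit Arguments.
Unset Strict Implicit.
Unset Printing Implicit Defensive.

Import Order.TTheory GRing.Theory Num.Theory.
Import numFieldNormedType.Exports.

Local Open Scope classical_set_scope.
Local Open Scope ring_scope.

(* If the dimension is finite, two adjacent long net intervals of level n lie in
   a ball of radius 4 lam^n and contain balls whose radius is only subexponentially
   smaller, so a single exponent, applied with delta small, bounds the ratio of
   their masses by q^n.

   Conversely, let x lie in [0, 1] and r <= rho, and let n be a level with
   rho <= f(n) lam^n, rho and lam^n being subexponentially comparable. The mass of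
   B(x, rho) comes from the words u of level n such that S_u[0, 1] contains x,
   starts in (x, x + rho) or ends in (x - rho, x). The first kind also charges
   B(x, r), with a loss that is a power of r / lam^n. By the gap condition the words
   of the second kind all start at the same point e. Either [e, e + r/2] lies in
   B(x, r), or there is a net interval next to e all of whose covering words contain
   x, and one use of the doubling condition moves the mass into it. Since doubling
   is used only once, and at a level M with r <= 4 lam^M, its cost q^M is a small
   negative power of r, absorbed by rho / r because r <= rho^(1 + delta). *)

(** * Words, their ratios, and stopping at a threshold *)

Section Words.
Context {R : realType} {m : nat} (S : ifs R m.+1).
Local Notation lam := (min_ratio S).

Lemma min_ratio_gt0 : 0 < lam.
Proof. by apply: lt_bigmin => // j _; exact: ratio_gt0. Qed.

Lemma min_ratio_le j : lam <= ratio S j.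
Proof. exact: bigmin_le_cond. Qed.

Lemma min_ratio_lt1 : lam < 1.
Proof. exact: le_lt_trans (min_ratio_le ord0) (ratio_lt1 S ord0). Qed.

Lemma ratio_upper : exists2 t : R, 0 < t < 1 & forall j, ratio S j <= t.
Proof.
exists (\big[Num.max/ratio S ord0]_j ratio S j); last first.
  by move=> j; exact: le_bigmax_cond.
apply/andP; split; last by apply: bigmax_lt => [|j _]; exact: ratio_lt1.
by apply: (lt_le_trans (ratio_gt0 S ord0)); exact: bigmax_ge_id.
Qed.

Lemma word_ratio_cons j u : word_ratio S (j :: u) = ratio S j * word_ratio S u.
Proof. by rewrite /word_ratio big_cons. Qed.

Lemma word_ratio_rcons u j : word_ratio S (rcons u j) = word_ratio S u * ratio S j.
Proof. by rewrite -cats1 /word_ratio big_cat big_seq1. Qed.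

Lemma word_ratio_gt0 u : 0 < word_ratio S u.
Proof. rewrite /word_ratio; elim: u => [|j u IH]; first by rewrite big_nil.
by rewrite big_cons mulr_gt0 ?ratio_gt0. Qed.

Lemma word_parent_rcons (u : seq 'I_m.+1) j : word_parent (rcons u j) = u.
Proof. by rewrite /word_parent size_rcons -cats1 take_size_cat. Qed.

Lemma word_parent_cons j (u : seq 'I_m.+1) :
  u <> [::] -> word_parent (j :: u) = j :: word_parent u.
Proof. by case: u. Qed.

Lemma word_mapE u x : word_map S u x = word_ratio S u * x + word_map S u 0.
Proof.
elim: u x => [|j u IH] x /=; first by rewrite /word_ratio big_nil mul1r addr0.
by rewrite /ifs_map IH [in RHS]IH word_ratio_cons; ring.
Qed.

Lemma word_mapB u x y :
  word_map S u x - word_map S u y = word_ratio S u * (x - y).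
Proof. by rewrite word_mapE (word_mapE u y); ring. Qed.

Lemma word_map_le u x y : (word_map S u x <= word_map S u y) = (x <= y).
Proof. by rewrite -subr_ge0 word_mapB pmulr_rge0 ?word_ratio_gt0// subr_ge0. Qed.

Lemma word_map_lt u x y : (word_map S u x < word_map S u y) = (x < y).
Proof. by rewrite -subr_gt0 word_mapB pmulr_rgt0 ?word_ratio_gt0// subr_gt0. Qed.

Lemma continuous_word_map u : continuous (word_map S u).
Proof.
have -> : word_map S u = fun x => word_ratio S u * x + word_map S u 0.
  by apply/funext => x; exact: word_mapE.
by move=> x; apply: cvgD; [apply: cvgMr; exact: cvg_id | exact: cvg_cst].
Qed.

Lemma measurable_word_map u :
  measurable_fun setT (word_map S u : measurableTypeR R -> measurableTypeR R).
Proof. by apply: continuous_measurable_fun; exact: continuous_word_map. Qed.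

(** The threshold is an arbitrary real because removing the first letter [j] turns [t] into
    [t / ratio S j], which need not be a power of [lam]. The empty word is allowed, and is the only
    stopped word when [1 <= t]. *)
Definition stopped (t : R) (u : seq 'I_m.+1) : Prop :=
  word_ratio S u <= t /\ (u <> [::] -> t < word_ratio S (word_parent u)).

Lemma stopped_nil t : 1 <= t -> stopped t [::].
Proof. by rewrite /stopped /word_ratio big_nil. Qed.

Lemma word_ratio_le1 u : word_ratio S u <= 1.
Proof.
elim: u => [|j u IH]; first by rewrite /word_ratio big_nil.
rewrite word_ratio_cons; apply: mulr_ile1 => //; apply/ltW;
  by [exact: ratio_gt0 | exact: word_ratio_gt0 | exact: ratio_lt1].
Qed.

Lemma stopped_ge1 t u : 1 <= t -> stopped t u -> u = [::].
Proof.
move=> t1 [_ ut]; apply: contrapT => /ut /(le_lt_trans t1).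
by rewrite ltNge word_ratio_le1.
Qed.

Lemma stopped_cons t j u : t < 1 ->
  stopped t (j :: u) <-> stopped (t / ratio S j) u.
Proof.
move=> t1; have j0 := ratio_gt0 S j.
rewrite /stopped word_ratio_cons ler_pdivlMr// mulrC.
split=> -[ut pt]; split=> // un.
  by move: pt; rewrite word_parent_cons// word_ratio_cons ltr_pdivrMr// mulrC; exact.
have [->|/eqP u0] := eqVneq u [::]; first by rewrite /word_ratio big_nil.
by rewrite word_parent_cons// word_ratio_cons mulrC -ltr_pdivrMr//; exact: pt.
Qed.

Lemma level_wordsE n u : (0 < n)%N -> level_words S n u <-> stopped (lam ^+ n) u.
Proof.
move=> n0; have ln1 : lam ^+ n < 1.
  by rewrite exprn_ilt1 ?ltW ?min_ratio_gt0 ?min_ratio_lt1// -lt0n.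
rewrite /level_words /stopped/=; split=> -[ut pt]; split=> //.
by apply: pt => u0; move: ut; rewrite u0 /word_ratio big_nil leNgt ln1.
Qed.

(** The last letter multiplies a ratio above [lam ^+ n] by at least [lam]. *)
Lemma level_words_gt n u : (0 < n)%N -> level_words S n u ->
  lam ^+ n.+1 < word_ratio S u.
Proof.
move=> n0 [ut]; case/lastP: u ut => [ut|u j _].
  by rewrite /word_parent/= => /(le_lt_trans ut); rewrite ltxx.
rewrite word_parent_rcons word_ratio_rcons exprSr => ut.
apply: (@le_lt_trans _ _ (lam ^+ n * ratio S j)).
  by rewrite ler_wpM2l ?exprn_ge0 ?(ltW min_ratio_gt0)// min_ratio_le.
by rewrite ltr_pM2r// ratio_gt0.
Qed.

(** Appending [j] shrinks the ratio geometrically; the first time it reaches [t] gives a stopped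
    word. *)
Lemma stopped_extend t u j : 0 < t ->
  (u <> [::] -> t < word_ratio S (word_parent u)) ->
  exists k, stopped t (u ++ nseq k j).
Proof.
move=> t0 ut.
have wr k : word_ratio S (u ++ nseq k j) = word_ratio S u * ratio S j ^+ k.
  by rewrite /word_ratio big_cat big_nseq iter_mulr_1.
have ex : exists k, word_ratio S (u ++ nseq k j) <= t.
  have /cvgrPdist_lt /(_ _ (divr_gt0 t0 (word_ratio_gt0 u))) [k _ /(_ k (leqnn k))] :
      ratio S j ^+ n @[n --> \oo] --> (0 : R).
    by apply: cvg_expr; rewrite ger0_norm ?ltW ?ratio_gt0 ?ratio_lt1.
  rewrite /= sub0r normrN ger0_norm ?exprn_ge0 ?(ltW (ratio_gt0 _ _))// => kt.
  by exists k; rewrite wr mulrC -ler_pdivlMr ?word_ratio_gt0// ltW.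
(* For a positive least exponent, minimality says that the parent is still above [t]; for exponent 0
   this is the hypothesis on [u]. *)
exists (ex_minn ex); case: ex_minnP => -[|k] uk mk.
  by split => //; rewrite cats0.
split=> // _; rewrite -(addn1 k) nseqD catA cats1 word_parent_rcons.
by rewrite ltNge; apply/negP => /mk; rewrite ltnn.
Qed.

Lemma word_map_nseq u j k z : ifs_map S j z = z ->
  word_map S (u ++ nseq k j) z = word_map S u z.
Proof.
by move=> jz; elim: u => [|i u IH] /=; [elim: k => //= k -> | rewrite IH].
Qed.

End Words.

(** * Real-valued mass and the support *)

Definition mass {R : realType} (mu : probability (measurableTypeR R) R)
  (E : set R) : R := fine (mu E).

Section Mass.
Context {R : realType} (mu : probability (measurableTypeR R) R).
Implicit Types A B : set (measurableTypeR R).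

Lemma massE A : measurable A -> mu A = (mass mu A)%:E.
Proof. by move=> mA; rewrite fineK// fin_num_measure. Qed.

Lemma mass_ge0 A : 0 <= mass mu A.
Proof. exact/fine_ge0/measure_ge0. Qed.

Lemma mass_le1 A : measurable A -> mass mu A <= 1.
Proof. by move=> mA; rewrite -lee_fin -massE// probability_le1. Qed.

Lemma le_mass A B : measurable A -> measurable B -> A `<=` B ->
  mass mu A <= mass mu B.
Proof. by move=> mA mB AB; rewrite -lee_fin -!massE// le_measure ?inE. Qed.

Lemma mass_setU A B : measurable A -> measurable B ->
  mass mu (A `|` B) <= mass mu A + mass mu B.
Proof.
move=> mA mB; rewrite -lee_fin EFinD -!massE//; last exact: measurableU.
exact: measureU2.
Qed.

Lemma support_compl_negligible : mu.-negligible (~` measure_support mu).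
Proof.
(* [F] enumerates the null balls with rational centre and radius [n.+1%:R^-1]; this countable family
   covers the complement of the support. *)
pose F k : set R := if unpickle k is Some (q, n)
  then let B := ball (ratr q : R) (n.+1%:R^-1 : R) in
    if mu B == 0%E then B else set0
  else set0.
have : mu.-negligible (\bigcup_k F k).
  apply: negligible_bigcup => k; rewrite /F.
  case: (unpickle k) => [[q n]|]; last exact: negligible_set0.
  case: ifPn => [/eqP B0|_]; last exact: negligible_set0.
  by apply/negligibleP => //; exact: measurable_ball.
suff FS : forall x : R, ~ measure_support mu x -> (\bigcup_k F k) x.
  by apply: negligibleS => x; exact: FS.
move=> x /existsNP[r /not_implyP[r0 /negP]].
rewrite lt0e measure_ge0 andbT negbK => /eqP xr0.
have [n nr] : exists n : nat, n.+1%:R^-1 < r / 2.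
  have [n _ /(_ n (leqnn n)) nr] :=
    near_infty_natSinv_lt (PosNum (divr_gt0 r0 (ltr0n R 2))).
  by exists n.
have n0 : 0 < n.+1%:R^-1 :> R by [].
have [q qx qr] : exists2 q, `|ratr q - x| < n.+1%:R^-1 &
    ball (ratr q : R) n.+1%:R^-1 `<=` ball x r.
  move: (n.+1%:R^-1) n0 nr => e e0 er.
  have xI : x - e < x + e by lra.
  have [q] := rat_in_itvoo xI; rewrite in_itv/= => qI; exists q.
    by rewrite ltr_norml; lra.
  by move=> y; rewrite /ball/= !ltr_norml => ?; lra.
have B0 : mu (ball (ratr q : R) n.+1%:R^-1) = 0%E.
  apply/eqP; rewrite eq_le measure_ge0 andbT -xr0.
  by apply: le_measure; rewrite ?inE//; exact: measurable_ball.
exists (pickle (q, n)); first exact: I.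
rewrite /F pickleK.
rewrite B0 eqxx.
exact: qx.
Qed.

End Mass.

(** * Self-similar measures: lower bounds for the mass and decomposition over words *)

Section SelfSimilar.
Context {R : realType} {m : nat} (S : ifs R m.+1) (p : 'I_m.+1 -> R)
  (mu : probability (measurableTypeR R) R).
Hypothesis attractorS : is_attractor S `[0, 1].
Hypothesis p_gt0 : forall j, 0 < p j.
Hypothesis p_sum1 : \sum_(j < m.+1) p j = 1.
Hypothesis mu_self_similar : self_similar S p mu.
Hypothesis mu_support : measure_support mu = `[0, 1]%classic.
Local Notation lam := (min_ratio S).
Implicit Types (A B E : set (measurableTypeR R)) (u : seq 'I_m.+1).

Lemma ifs_map01 j y : 0 <= y <= 1 -> 0 <= ifs_map S j y <= 1.
Proof.
move=> y01; have [_ _ F] := attractorS.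
have : `[0, 1]%classic (ifs_map S j y).
  by rewrite F; exists j => //; exists y => //=; rewrite in_itv.
by rewrite /= in_itv.
Qed.

Lemma ifs_map01_inv y : 0 <= y <= 1 ->
  exists j, exists2 y', 0 <= y' <= 1 & y = ifs_map S j y'.
Proof.
move=> y01; have [_ _ F] := attractorS.
have : `[0, 1]%classic y by rewrite /= in_itv.
by rewrite F => -[j _ [y' /=]]; rewrite in_itv/= => y'01 <-; exists j, y'.
Qed.

Lemma word_map01 u y : 0 <= y <= 1 -> 0 <= word_map S u y <= 1.
Proof. by elim: u => //= j u IH y01; exact/ifs_map01/IH. Qed.

Lemma measurable_word_preimage u E : measurable E ->
  measurable (word_map S u @^-1` E).
Proof.
by move=> mE; rewrite -[X in measurable X]setTI; exact: measurable_word_map.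
Qed.

Lemma mass_self_similar E : measurable E ->
  mass mu E = \sum_j p j * mass mu (ifs_map S j @^-1` E).
Proof.
move=> mE; apply: EFin_inj; rewrite -massE// mu_self_similar// -sumEFin.
apply: eq_bigr => j _; rewrite EFinM -massE//.
exact: (measurable_word_preimage [:: j]).
Qed.

Lemma mass_ifs_le j E : measurable E ->
  p j * mass mu (ifs_map S j @^-1` E) <= mass mu E.
Proof.
move=> mE; rewrite (mass_self_similar mE) (bigD1 j)//= lerDl sumr_ge0// => i _.
by rewrite mulr_ge0 ?mass_ge0// ltW.
Qed.

Lemma mass01 : mass mu `[0, 1]%classic = 1.
Proof.
apply: EFin_inj; rewrite -massE// -(probability_setT mu).
have mC : measurable (~` `[0, 1] : set (measurableTypeR R)) by exact: measurableC.
rewrite -(setvU `[0, 1]%classic) measureU//=; last by rewrite setICl.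
rewrite [X in (X + _)%E](_ : _ = 0%E) ?add0e//.
by apply/negligibleP => //; rewrite -mu_support; exact: support_compl_negligible.
Qed.

Lemma le_mass01 A B : measurable A -> measurable B ->
  (forall x, 0 <= x <= 1 -> A x -> B x) -> mass mu A <= mass mu B.
Proof.
move=> mA mB AB; have m01 : measurable (`[0, 1]%classic : set (measurableTypeR R)) by [].
have mC := measurableC m01.
have C0 : mass mu (~` `[0, 1]%classic) = 0.
  rewrite /mass; suff -> : mu (~` `[0, 1]%classic) = 0%E by [].
  by apply/negligibleP => //; rewrite -mu_support; exact: support_compl_negligible.
rewrite -[leRHS]addr0 -C0; apply: le_trans (mass_setU mu _ _) => //.
apply: le_mass => //; first exact: measurableU.
move=> x Ax; have [x01|] := boolP (x \in `[0, 1]).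
  by left; apply: AB => //; rewrite in_itv/= in x01.
by move=> /negP x01; right.
Qed.

(** Within [0, 1] the preimage of [z] under each map is at most [z] itself, and under map [i] it is
    empty. Self-similarity then bounds the mass of the point by [1 - p i] times itself. *)
Lemma mass_endpoint z i : (forall j y, 0 <= y <= 1 -> ifs_map S j y = z -> y = z) ->
  ifs_map S i z <> z -> mass mu [set z] = 0.
Proof.
move=> extz iz.
have mz : measurable ([set z] : set (measurableTypeR R)) by [].
have mS j : measurable (ifs_map S j @^-1` [set z] : set (measurableTypeR R)).
  exact: (@measurable_word_preimage [:: j]).
have le j : mass mu (ifs_map S j @^-1` [set z]) <= mass mu [set z].
  by apply: le_mass01 => // x x01 /= /extz ->.
have le0 : mass mu (ifs_map S i @^-1` [set z]) <= 0.
  have -> : 0 = mass mu set0 by rewrite /mass measure0.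
  apply: le_mass01 => // x x01 /= xz; apply: iz.
    by rewrite -[in LHS](extz i x x01 xz).
have : mass mu [set z] <= (1 - p i) * mass mu [set z].
  rewrite [leLHS]mass_self_similar// (bigD1 i)//= -[leRHS]add0r lerD//.
    by rewrite mulr_ge0_le0// ltW.
  have -> : 1 - p i = \sum_(j < m.+1 | j != i) p j.
    by have := p_sum1; rewrite (bigD1 i)//= => <-; rewrite addrAC subrr add0r.
  rewrite mulr_suml ler_sum// => j _.
  by rewrite ler_wpM2l// ltW.
rewrite mulrBl mul1r => le1; have {le1} : p i * mass mu [set z] <= 0 by lra.
rewrite pmulr_rle0// => z0.
by apply/eqP; rewrite eq_le z0 mass_ge0.
Qed.

(** [E] is any measurable set containing the part in [0, 1] of the closed ball of centre [y] and
    radius [t], so that the bound applies directly to preimages. *)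
Definition power_lower_bound (c s : R) : Prop := forall y t E,
  0 <= y <= 1 -> 0 < t <= 1 -> measurable E ->
  (forall z, 0 <= z <= 1 -> `|z - y| <= t -> E z) -> c * t `^ s <= mass mu E.

(** Pulling a ball back by a map whose image contains its centre enlarges the radius by a factor at
    least [rho^-1] and costs a factor [p j >= q]. After about ln t / ln rho steps the ball contains
    [0, 1]. *)
Lemma mass_lower : exists c s : R, [/\ 0 < c, 0 < s & power_lower_bound c s].
Proof.
have [rho /andP[rho0 rho1] le_rho] := ratio_upper S.
pose b := \big[Num.min/p ord0]_j p j.
have b0 : 0 < b by rewrite lt_bigmin.
have le_b j : b <= p j by exact: bigmin_le_cond.
(* Halving [b] ensures [q < 1], so that the exponent [ln q / ln rho] is positive. *)
have [q q0 [q1 qb]] : exists2 q, 0 < q & q < 1 /\ q <= b.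
  have : p ord0 <= 1.
    by rewrite -p_sum1 (bigD1 ord0)//= lerDl sumr_ge0// => j _; exact: ltW.
  by have := le_b ord0; exists (b / 2); [|split]; lra.
have le_q j : q <= p j by exact: le_trans qb (le_b j).
have step k : forall y t E, 0 <= y <= 1 -> rho ^+ k <= t -> measurable E ->
    (forall z, 0 <= z <= 1 -> `|z - y| <= t -> E z) -> q ^+ k <= mass mu E.
  elim: k => [|k IH] y t E y01 kt mE tE.
    rewrite expr0 -mass01; apply: le_mass01 => // z z01 _; apply: tE => //.
    by apply: le_trans kt; rewrite expr0 ler_norml; lra.
  have [j [y' y'01 yE]] := ifs_map01_inv y01.
  apply: le_trans (mass_ifs_le j mE); rewrite exprS ler_pM ?exprn_ge0 ?(ltW q0)//.
  apply: (IH y' (t / ratio S j)) => //.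
  - rewrite ler_pdivlMr ?ratio_gt0//; apply: le_trans kt.
    by rewrite exprSr ler_wpM2l ?exprn_ge0 ?(ltW rho0)// le_rho.
  - exact: (measurable_word_preimage [:: j]).
  - move=> z z01 zy; apply: tE; first exact: ifs_map01.
    have -> : ifs_map S j z - y = ratio S j * (z - y').
      by rewrite yE /ifs_map; ring.
    by rewrite normrM (gtr0_norm (ratio_gt0 S j)) mulrC -ler_pdivlMr ?ratio_gt0.
have lrho : ln rho < 0 by rewrite -ln1 ltr_ln ?posrE.
have lq : ln q < 0 by rewrite -ln1 ltr_ln ?posrE.
have s0 : 0 < ln q / ln rho by rewrite nmulr_rgt0// invr_lt0.
exists q, (ln q / ln rho); split => //.
move=> y t E y01 /andP[t0 t1] mE tE.
have ex : exists k, rho ^+ k <= t.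
  have /cvgrPdist_lt /(_ _ t0) [k _ /(_ k (leqnn k))] :
      rho ^+ n @[n --> \oo] --> (0 : R).
    by apply: cvg_expr; rewrite ger0_norm ?ltW.
  rewrite /= sub0r normrN ger0_norm ?exprn_ge0 ?(ltW rho0)// => kt.
  by exists k; rewrite ltW.
move: (ex_minnP ex) => [k kt mk].
apply: le_trans (step k y t E y01 kt mE tE).
case: k kt mk => [|k] kt mk.
  rewrite expr0; apply: mulr_ile1; rewrite ?powR_ge0 ?(ltW q0) ?(ltW q1)//.
  have := @ge0_ler_powR R _ (ltW s0) t 1; rewrite powR1.
  by apply; rewrite // nnegrE ltW.
have {mk}kt' : t < rho ^+ k by rewrite ltNge; apply/negP => /mk; rewrite ltnn.
(* One factor [q] is the constant [c]; the other [k] factors form the power of [rho ^+ k], which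
   exceeds [t] by minimality. *)
rewrite exprS ler_wpM2l// ?(ltW q0)//.
have -> : q ^+ k = (rho ^+ k) `^ (ln q / ln rho).
  have qE : rho `^ (ln q / ln rho) = q.
    by rewrite /powR gt_eqF// divfK ?lt_eqF// lnK ?posrE.
  by rewrite -[in LHS]qE -!powR_mulrn ?powR_ge0 ?(ltW rho0)// -!powRrM mulrC.
by apply: ge0_ler_powR;
  rewrite ?nnegrE ?exprn_ge0 ?(ltW rho0) ?(ltW t0) ?(ltW kt') ?(ltW s0).
Qed.

Definition word_prob (u : seq 'I_m.+1) : R := \prod_(j <- u) p j.

Lemma word_prob_ge0 u : 0 <= word_prob u.
Proof. by apply: prodr_ge0 => j _; exact: ltW. Qed.

(** The last two clauses are the iterated self-similarity of [mu] and of the attractor along the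
    words of [P]. *)
Definition decomposes (W : seq (seq 'I_m.+1)) (P : seq 'I_m.+1 -> Prop) : Prop :=
  [/\ forall u, u \in W <-> P u,
      forall E, measurable E ->
        mass mu E = \sum_(u <- W) word_prob u * mass mu (word_map S u @^-1` E)
    & forall y, 0 <= y <= 1 ->
        exists2 u, P u & exists2 y', 0 <= y' <= 1 & y = word_map S u y'].

(** Induction on [k] with [rho ^+ k <= t]: splitting off the first letter [j] raises the threshold
    to [t / ratio S j], which is at least [rho ^+ k.-1]. From threshold 1 on, only the empty word
    remains. *)
Lemma stopped_enum t : 0 < t -> exists W : seq (seq 'I_m.+1),
  decomposes W (stopped S t).
Proof.
have [rho /andP[rho0 rho1] le_rho] := ratio_upper S.
have single t' : 1 <= t' -> exists W : seq (seq 'I_m.+1),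
    decomposes W (stopped S t').
  move=> t1; exists [:: [::]]; split.
  - move=> u; rewrite inE; split => [/eqP ->|/(stopped_ge1 t1) ->//].
    exact: stopped_nil.
  - by move=> E mE; rewrite big_seq1 /word_prob big_nil mul1r.
  - by move=> y y01; exists [::]; [exact: stopped_nil | exists y].
move=> t0.
have [k kt] : exists k, rho ^+ k <= t.
  have /cvgrPdist_lt /(_ _ t0) [k _ /(_ k (leqnn k))] :
      rho ^+ n @[n --> \oo] --> (0 : R).
    by apply: cvg_expr; rewrite ger0_norm ?ltW.
  rewrite /= sub0r normrN ger0_norm ?exprn_ge0 ?(ltW rho0)// => kt.
  by exists k; rewrite ltW.
elim: k t t0 kt => [|k IH] t t0 kt; first exact: single.
have [/single//|t1] := leP 1 t.
have IHj j : exists W : seq (seq 'I_m.+1),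
    decomposes W (stopped S (t / ratio S j)).
  apply: IH; first by rewrite divr_gt0 ?ratio_gt0.
  rewrite ler_pdivlMr ?ratio_gt0//; apply: le_trans kt.
  by rewrite exprSr ler_wpM2l ?exprn_ge0 ?(ltW rho0)// le_rho.
have [F FP] := choice IHj.
exists [seq j :: u | j <- enum 'I_m.+1, u <- F j]; split.
- move=> u; split.
    move=> /allpairsPdep[j [v [_ vF ->]]].
    by apply/stopped_cons => //; have [+ _ _] := FP j; move=> /(_ v)[+ _]; exact.
  case: u => [|j u].
    by move=> [+ _]; rewrite /word_ratio big_nil => /(lt_le_trans t1); rewrite ltxx.
  move=> /stopped_cons-/(_ t1) ju; apply/allpairsPdep; exists j, u.
  by rewrite mem_enum; split=> //; have [+ _ _] := FP j; move=> /(_ u)[_]; exact.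
- move=> E mE; rewrite big_allpairs_dep/= big_enum/= (mass_self_similar mE).
  apply: eq_bigr => j _; have [_ + _] := FP j.
  move=> /(_ (ifs_map S j @^-1` E)) ->; last exact: (@measurable_word_preimage [:: j]).
  by rewrite mulr_sumr; apply: eq_bigr => u _; rewrite /word_prob big_cons mulrA.
- move=> y /ifs_map01_inv[j [y' y'01 ->]]; have [_ _ +] := FP j.
  move=> /(_ y' y'01)[u uF [y'' y''01 ->]].
  by exists (j :: u); [exact/stopped_cons | exists y''].
Qed.

Lemma level_enum n : (0 < n)%N -> exists W : seq (seq 'I_m.+1),
  decomposes W (level_words S n).
Proof.
move=> n0; have [W [WP mW cW]] := stopped_enum (exprn_gt0 n (min_ratio_gt0 S)).
exists W; split => // [u|y /cW[u uP yu]]; first by rewrite level_wordsE.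
by exists u => //; exact/level_wordsE.
Qed.

(** Since [word_ratio S u <= lam ^+ n], a ball of radius [t] about a point of the piece of [u] pulls
    back to a ball of radius at least [t / lam ^+ n], to which the power lower bound applies. *)
Lemma mass_ge_words n W c s (P : pred (seq 'I_m.+1)) t E : (0 < n)%N ->
  decomposes W (level_words S n) -> power_lower_bound c s ->
  0 < t <= lam ^+ n -> measurable E ->
  (forall u, level_words S n u -> P u -> exists2 y, 0 <= y <= 1 &
    forall z, 0 <= z <= 1 -> `|word_map S u z - word_map S u y| <= t ->
      E (word_map S u z)) ->
  (\sum_(u <- W | P u) word_prob u) * (c * (t / lam ^+ n) `^ s) <= mass mu E.
Proof.
move=> n0 [WP mW _] low /andP[t0 tn] mE PE.
have ln0 : 0 < lam ^+ n by rewrite exprn_gt0// min_ratio_gt0.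
rewrite mW// [leRHS](bigID P)/= -[leLHS]addr0 lerD//; last first.
  by apply: sumr_ge0 => u _; rewrite mulr_ge0 ?word_prob_ge0 ?mass_ge0.
rewrite mulr_suml big_seq_cond [leRHS]big_seq_cond.
apply: ler_sum => u /andP[/WP uW Pu]; rewrite ler_wpM2l ?word_prob_ge0//.
have [y y01 yE] := PE u uW Pu.
apply: (low y) => //.
- by rewrite divr_gt0//= ler_pdivrMr// mul1r.
- exact: measurable_word_preimage.
- move=> z z01 zy; apply: yE => //; rewrite word_mapB normrM.
  rewrite (gtr0_norm (word_ratio_gt0 S u)) -[leRHS](divfK (lt0r_neq0 ln0)) mulrC.
  by apply: ler_pM => //; [exact/ltW/word_ratio_gt0 | case: uW].
Qed.

Lemma mass_le_words W (L : seq 'I_m.+1 -> Prop) (P : pred (seq 'I_m.+1)) E :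
  decomposes W L -> measurable E ->
  (forall u, L u -> ~~ P u -> mass mu (word_map S u @^-1` E) = 0) ->
  mass mu E <= \sum_(u <- W | P u) word_prob u.
Proof.
move=> [WP mW _] mE PE.
rewrite mW// (bigID P)/= [X in _ + X]big_seq_cond [X in _ + X]big1 ?addr0.
  apply: ler_sum => u _; rewrite ler_piMr ?word_prob_ge0//.
  by apply: mass_le1; exact: measurable_word_preimage.
by move=> u /andP[/WP uW nP]; rewrite (PE u)// mulr0.
Qed.

(** * Net points, net intervals and their neighbours *)

Section NetIntervals.
Variable f : nat -> R.
Hypothesis S_first : ifs_map S ord0 0 = 0.
Hypothesis S_last : ifs_map S ord_max 1 = 1.
Hypothesis agwscS : agwsc S f.
Hypothesis f_lt : forall n, (0 < n)%N -> f n < lam.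

(** Images of 0 and of 1 are kept apart because the gap condition only compares images of the same
    point. *)
Definition endpoint n (z x : R) : Prop :=
  exists2 u, level_words S n u & x = word_map S u z.

Lemma net_pointsE n x : (0 < n)%N ->
  net_points S n x <-> endpoint n 0 x \/ endpoint n 1 x.
Proof.
case: n => // n _; split => [[u uL [->|->]]|[[u uL ->]|[u uL ->]]].
- by left; exists u.
- by right; exists u.
- by exists u => //; left.
- by exists u => //; right.
Qed.

Lemma net_points01 n x : net_points S n x -> 0 <= x <= 1.
Proof.
case: n => [[->|->]|n [u _ [->|->]]]; rewrite ?lexx ?ler01//;
  by apply: word_map01; rewrite ?lexx ?ler01.
Qed.

Definition gap n : R := f n * lam ^+ n.

Lemma gap_gt0 n : (0 < n)%N -> 0 < gap n.
Proof.
by case: agwscS => f0 _ _ _ n0; rewrite mulr_gt0 ?f0// exprn_gt0// min_ratio_gt0.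
Qed.

Lemma gap_lt n : (0 < n)%N -> gap n < lam ^+ n.+1.
Proof.
by move=> n0; rewrite /gap exprS ltr_pM2r ?f_lt// exprn_gt0// min_ratio_gt0.
Qed.

Lemma gapS n : (0 < n)%N -> gap n.+1 <= gap n.
Proof.
move=> n0; case: agwscS => f0 fle _ _; apply: ler_pM.
- exact/ltW/f0.
- by rewrite exprn_ge0// ltW// min_ratio_gt0.
- exact: fle.
- by rewrite exprS ler_piMl ?exprn_ge0 ?ltW ?min_ratio_gt0 ?min_ratio_lt1.
Qed.

Lemma endpoint_gap n z x y : (0 < n)%N -> z = 0 \/ z = 1 ->
  endpoint n z x -> endpoint n z y -> x < y -> gap n <= y - x.
Proof.
move=> n0 z01 [u uL ->] [w wL ->] uw.
rewrite -(@gtr0_norm _ (_ - _)) ?subr_gt0//.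
by case: agwscS => _ _ _; apply=> //; rewrite gt_eqF.
Qed.

(* Two of three net points are images of the same endpoint of [0, 1]. *)
Lemma net_points_gap n x y z : (0 < n)%N ->
  net_points S n x -> net_points S n y -> net_points S n z ->
  x < y -> y < z -> gap n <= z - x.
Proof.
move=> n0 /net_pointsE-/(_ n0) xn /net_pointsE-/(_ n0) yn /net_pointsE-/(_ n0) zn.
have l0 : (0 : R) = 0 \/ (0 : R) = 1 by left.
have l1 : (1 : R) = 0 \/ (1 : R) = 1 by right.
move=> xy yz; have xz := lt_trans xy yz.
case: xn => xn; case: yn => yn; case: zn => zn;
  do [by have := endpoint_gap n0 l0 xn zn xz; lra
    | by have := endpoint_gap n0 l1 xn zn xz; lra
    | by have := endpoint_gap n0 l0 xn yn xy; lra
    | by have := endpoint_gap n0 l1 xn yn xy; lra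
    | by have := endpoint_gap n0 l0 yn zn yz; lra
    | by have := endpoint_gap n0 l1 yn zn yz; lra].
Qed.

(** The point [z] is fixed by the first or the last map, so repeating that letter at the end of [u]
    until level [n] is reached leaves the image of [z] unchanged. *)
Lemma endpoint_extend n z u : (0 < n)%N -> z = 0 \/ z = 1 ->
  (u <> [::] -> lam ^+ n < word_ratio S (word_parent u)) ->
  endpoint n z (word_map S u z).
Proof.
move=> n0 z01 uP.
have [j jz] : exists j, ifs_map S j z = z.
  by case: z01 => ->; [exists ord0 | exists ord_max].
have [k kP] := stopped_extend j (exprn_gt0 n (min_ratio_gt0 S)) uP.
by exists (u ++ nseq k j); [exact/level_wordsE | rewrite word_map_nseq].
Qed.

Lemma endpointS n z x : (0 < n)%N -> z = 0 \/ z = 1 ->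
  endpoint n z x -> endpoint n.+1 z x.
Proof.
move=> n0 z01 [u [_ uP] ->]; apply: endpoint_extend => // _.
apply: le_lt_trans uP.
by rewrite exprS ler_piMl ?exprn_ge0 ?ltW ?min_ratio_gt0 ?min_ratio_lt1.
Qed.

Lemma endpoint_id n z : (0 < n)%N -> z = 0 \/ z = 1 -> endpoint n z z.
Proof. by move=> n0 z01; apply: (@endpoint_extend n z [::]). Qed.

Lemma net_pointsS n x : (0 < n)%N -> net_points S n x -> net_points S n.+1 x.
Proof.
move=> n0 /net_pointsE-/(_ n0) xn; apply/net_pointsE => //.
by case: xn => /endpointS h; [left | right]; apply: h => //; [left | right].
Qed.

Lemma finite_argmax (s : seq R) (P : pred R) : has P s ->
  exists2 a, a \in s /\ P a & forall h, h \in s -> P h -> h <= a.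
Proof.
elim: s => //= x s IH; have [/IH[a [sa Pa] ale] _|ns] := boolP (has P s).
  have [Px|nPx] := boolP (P x); last first.
    exists a; rewrite ?inE ?sa ?orbT//; move=> h.
    by rewrite inE => /orP[/eqP -> Px|]; [rewrite Px in nPx | exact: ale].
  exists (Num.max a x).
    by rewrite /Num.max; case: ifP; rewrite !inE ?eqxx ?sa ?orbT.
  move=> h; rewrite inE le_max => /orP[/eqP -> _|hs Ph]; first by rewrite lexx orbT.
  by rewrite ale.
rewrite orbF => Px; exists x; first by rewrite inE eqxx.
move=> h; rewrite inE => /orP[/eqP ->//|hs Ph].
by have /negP[] := ns; apply/hasP; exists h.
Qed.

Lemma net_points_enum n : (0 < n)%N ->
  exists s : seq R, forall x, x \in s <-> net_points S n x.
Proof.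
move=> n0; have [W [WP _ _]] := level_enum n0.
exists ([seq word_map S u 0 | u <- W] ++ [seq word_map S u 1 | u <- W]) => x.
rewrite mem_cat; split.
  case/orP => /mapP[u /WP uL ->]; apply/net_pointsE => //.
    by left; exists u.
  by right; exists u.
move=> /net_pointsE-/(_ n0)[[u /WP uL ->]|[u /WP uL ->]]; apply/orP.
  by left; exact: map_f.
by right; exact: map_f.
Qed.

(** This version and the next one differ when [x] is a net point: here the interval continues to the
    right of [x], there to the left. *)
Lemma net_interval_right n x : (0 < n)%N -> 0 <= x < 1 ->
  exists a b, [/\ net_interval S n a b, a <= x & x < b].
Proof.
move=> n0 /andP[x0 x1]; have [s sP] := net_points_enum n0.
have /finite_argmax[a [/sP an ax] amax] : has (fun h => h <= x) s.
  apply/hasP; exists 0 => //; apply/sP/net_pointsE => //.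
  by left; apply: endpoint_id => //; left.
(* The least net point above [x] is found as a maximum over the negated list. *)
have /finite_argmax[b' [b's bx] bmin] : has (fun h => x < - h) [seq - h | h <- s].
  apply/hasP; exists (- 1); last by rewrite opprK.
  apply: map_f; apply/sP/net_pointsE => //.
  by right; apply: endpoint_id => //; right.
case/mapP: b's => b /sP bn b'E; subst b'; rewrite opprK in bx.
exists a, b; split => //; split => //; first exact: le_lt_trans bx.
move=> h /sP hs /andP[ah hb]; have [hx|xh] := leP h x.
  by have := amax h hs hx; rewrite leNgt ah.
have := bmin (- h); rewrite opprK lerN2 leNgt hb => /(_ _ xh) H.
by have := H (map_f _ hs).
Qed.

Lemma net_interval_left n x : (0 < n)%N -> 0 < x <= 1 ->
  exists a b, [/\ net_interval S n a b, a < x & x <= b].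
Proof.
move=> n0 /andP[x0 x1]; have [s sP] := net_points_enum n0.
have /finite_argmax[a [/sP an ax] amax] : has (fun h => h < x) s.
  apply/hasP; exists 0 => //; apply/sP/net_pointsE => //.
  by left; apply: endpoint_id => //; left.
have /finite_argmax[b' [b's bx] bmin] : has (fun h => x <= - h) [seq - h | h <- s].
  apply/hasP; exists (- 1); last by rewrite opprK.
  apply: map_f; apply/sP/net_pointsE => //.
  by right; apply: endpoint_id => //; right.
case/mapP: b's => b /sP bn b'E; subst b'; rewrite opprK in bx.
exists a, b; split => //; split => //; first exact: lt_le_trans bx.
move=> h /sP hs /andP[ah hb]; have [xh|hx] := leP x h.
  have := bmin (- h); rewrite opprK lerN2 => /(_ _ xh); rewrite leNgt hb => H.
  by have := H (map_f _ hs).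
by have := amax h hs hx; rewrite leNgt ah.
Qed.

(** The midpoint lies in the piece of some level [n] word; the ends of that piece are net points,
    hence not inside the interval, so the piece contains all of it. *)
Lemma net_interval_length n a b : (0 < n)%N -> net_interval S n a b ->
  b - a <= lam ^+ n.
Proof.
move=> n0 [an bn ab nab]; have [W [_ _ cW]] := level_enum n0.
have /andP[a0 _] := net_points01 an; have /andP[_ b1] := net_points01 bn.
have [u uL [y y01 yE]] : exists2 u, level_words S n u &
    exists2 y', 0 <= y' <= 1 & (a + b) / 2 = word_map S u y'.
  by apply: cW; lra.
have /andP[y0 y1] := y01.
have u0 : word_map S u 0 <= a.
  rewrite leNgt; apply/negP => au.
  apply: (nab (word_map S u 0)); first by apply/net_pointsE => //; left; exists u.
  by rewrite au; have := word_map_le S u 0 y; rewrite y0 -yE => h; lra.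
have u1 : b <= word_map S u 1.
  rewrite leNgt; apply/negP => ub.
  apply: (nab (word_map S u 1)); first by apply/net_pointsE => //; right; exists u.
  by rewrite ub andbT; have := word_map_le S u y 1; rewrite y1 -yE => h; lra.
have := word_mapB S u 1 0; rewrite subr0 mulr1 => uE.
by case: uL => + _; lra.
Qed.

(** A new net point inside would be the middle one of three, forcing length at least [gap n.+1]. *)
Lemma net_interval_persist n a b : (0 < n)%N -> net_interval S n a b ->
  b - a < gap n.+1 -> net_interval S n.+1 a b.
Proof.
move=> n0 [an bn ab nab] short; split => //; [exact: net_pointsS..|].
move=> x xn /andP[ax xb].
have : gap n.+1 <= b - a.
  by apply: (@net_points_gap n.+1 a x b) => //; exact: net_pointsS.
by rewrite leNgt short.
Qed.

(** [M] is the least level from [n] on at which the interval is long enough for the doubling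
    condition; up to there it persists, being too short to be cut. *)
Lemma net_interval_last n a b : (0 < n)%N -> net_interval S n a b ->
  exists M, [/\ (n <= M)%N, net_interval S M a b, gap M.+1 <= b - a &
    M = n \/ b - a < gap M].
Proof.
move=> n0 nab; have [_ _ ab _] := nab.
have ba0 : 0 < b - a by rewrite subr_gt0.
have lam0 := min_ratio_gt0 S; have lam1 := min_ratio_lt1 S.
have ex : exists k, (n <= k)%N && (gap k.+1 <= b - a).
  have /cvgrPdist_lt /(_ _ ba0) [k _ kP] : lam ^+ n @[n --> \oo] --> (0 : R).
    by apply: cvg_expr; rewrite gtr0_norm.
  exists (maxn n k); rewrite leq_maxl/=.
  have := kP (maxn n k) (leq_maxr n k).
  rewrite /= sub0r normrN ger0_norm ?exprn_ge0 ?(ltW lam0)// => /ltW; apply: le_trans.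
  apply/ltW/(lt_le_trans (gap_lt _)) => //.
  by rewrite ler_wiXn2l ?(ltW lam0) ?(ltW lam1)// -addn2 leq_addr.
move: (ex_minnP ex) => [k /andP[nk kab] kmin].
have persist j : (n <= j <= k)%N -> net_interval S j a b.
  elim: j => [|j IH] /andP[nj jk]; first by move: n0 nj; case: (n).
  move: nj; rewrite leq_eqVlt => /predU1P[<-//|]; rewrite ltnS => nj.
  apply: net_interval_persist; first exact: leq_trans nj.
    by apply: IH; rewrite nj ltnW.
  rewrite ltNge; apply/negP => jab.
  by have := kmin j; rewrite nj jab => /(_ isT); rewrite leqNgt jk.
exists k; split => //; first by apply: persist; rewrite nk leqnn.
move: nk; rewrite leq_eqVlt => /predU1P[->|]; first by left.
case: k kab kmin {persist} => // k kab kmin; rewrite ltnS => nk; right.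
rewrite ltNge; apply/negP => kab'.
by have := kmin k; rewrite nk kab' ltnn => /(_ isT).
Qed.

Lemma setU_itvcc (x y z : R) : x <= y -> y <= z ->
  `[x, y] `|` `[y, z] = `[x, z]%classic.
Proof.
move=> xy yz; apply/seteqP; split => t /=; rewrite !in_itv/=.
  by move=> [|] /andP[? ?]; lra.
by move=> /andP[xt tz]; have [ty|yt] := leP t y; [left | right]; lra.
Qed.

(** A single adjacent interval may be arbitrarily short, but two of them span three net points and
    so have total length at least [gap n]. *)
Lemma net_right_exists n b : (0 < n)%N -> net_points S n b -> b < 1 ->
  exists d, net_right S n b `[b, d]%classic /\ (d = 1 \/ gap n <= d - b).
Proof.
move=> n0 bn b1; have /andP[b0 _] := net_points01 bn.
have next x : net_points S n x -> 0 <= x < 1 -> exists y, net_interval S n x y.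
  move=> xn /(net_interval_right n0)[a [y [[an yn ay nay] ax xy]]].
  move: ax; rewrite le_eqVlt => /predU1P[<-|ax]; first by exists y.
  by have := nay x xn; rewrite ax xy.
have [|c bc] := next b bn; first by rewrite b0.
have [_ cn ltbc _] := bc.
have /andP[c0 ] := net_points01 cn; rewrite le_eqVlt => /predU1P[c1|c1].
  by exists c; split; [exists c => //; left | left].
have [|d cd] := next c cn; first by rewrite c0.
have [_ dn ltcd _] := cd.
exists d; split; last by right; exact: net_points_gap cn dn ltbc ltcd.
exists c => //; right; exists d => //.
by rewrite setU_itvcc// ltW.
Qed.

Lemma net_left_exists n a : (0 < n)%N -> net_points S n a -> 0 < a ->
  exists d, net_left S n a `[d, a]%classic /\ (d = 0 \/ gap n <= a - d).
Proof.
move=> n0 an a0; have /andP[_ a1] := net_points01 an.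
have prev x : net_points S n x -> 0 < x <= 1 -> exists y, net_interval S n y x.
  move=> xn /(net_interval_left n0)[y [b [[yn bn yb nyb] yx xb]]].
  move: xb; rewrite le_eqVlt => /predU1P[->|xb]; first by exists y.
  by have := nyb x xn; rewrite yx xb.
have [|c ca] := prev a an; first by rewrite a0.
have [cn _ ltca _] := ca.
have /andP[+ c1] := net_points01 cn; rewrite le_eqVlt => /predU1P[c0|c0].
  by exists c; split; [exists c => //; left | left].
have [|d dc] := prev c cn; first by rewrite c0.
have [dn _ ltdc _] := dc.
exists d; split; last by right; exact: net_points_gap dn cn _ ltdc ltca.
exists c => //; right; exists d => //.
by rewrite setU_itvcc// ltW.
Qed.

Lemma net_right_shape n b D : (0 < n)%N -> net_right S n b D ->
  exists d, [/\ D = `[b, d]%classic, 0 <= b, d <= 1, gap n.+1 <= d - b &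
    d - b <= 2 * lam ^+ n].
Proof.
move=> n0 [c bc cD]; have [bn cn ltbc _] := bc.
have lbc := net_interval_length n0 bc.
have lam0 := exprn_gt0 n (min_ratio_gt0 S).
have /andP[b0 _] := net_points01 bn.
case: cD => [[c1 ->]|[d cd ->]].
  subst c; exists 1; split => //; last lra.
  (* If [b] is an image of 1, the gap condition separates it from 1; if it is an image of 0, the
     piece starting at [b] fits in [b, 1] and is longer than [lam ^+ n.+1]. *)
  move/net_pointsE : bn => /(_ n0)[[u uL bE]|b1]; last first.
    apply: le_trans (gapS n0) _; apply: (endpoint_gap n0 _ b1) => //; first by right.
    by apply: endpoint_id => //; right.
  apply: le_trans (ltW (gap_lt (ltn0Sn n))) _.
  apply: (@le_trans _ _ (lam ^+ n.+1)).
    by rewrite [leLHS]exprS ler_piMl ?exprn_ge0 ?ltW ?min_ratio_gt0 ?min_ratio_lt1.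
  have := level_words_gt n0 uL; have := word_mapB S u 1 0.
  have /andP[_ ] := @word_map01 u 1 (introT andP (conj ler01 (lexx 1))).
  by rewrite bE; lra.
have [_ dn ltcd _] := cd; have lcd := net_interval_length n0 cd.
have /andP[_ d1] := net_points01 dn.
exists d; split => //; [by rewrite setU_itvcc// ltW| |lra].
exact: le_trans (gapS n0) (net_points_gap n0 bn cn dn ltbc ltcd).
Qed.

Lemma net_left_shape n a D : (0 < n)%N -> net_left S n a D ->
  exists d, [/\ D = `[d, a]%classic, 0 <= d, a <= 1, gap n.+1 <= a - d &
    a - d <= 2 * lam ^+ n].
Proof.
move=> n0 [c ca cD]; have [cn an ltca _] := ca.
have lca := net_interval_length n0 ca.
have lam0 := exprn_gt0 n (min_ratio_gt0 S).
have /andP[_ a1] := net_points01 an.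
case: cD => [[c0 ->]|[d dc ->]].
  subst c; exists 0; split => //; last lra.
  move/net_pointsE : an => /(_ n0)[a0|[u uL aE]].
    apply: le_trans (gapS n0) _; apply: (endpoint_gap n0 _ _ a0) => //; first by left.
    by apply: endpoint_id => //; left.
  apply: le_trans (ltW (gap_lt (ltn0Sn n))) _.
  apply: (@le_trans _ _ (lam ^+ n.+1)).
    by rewrite [leLHS]exprS ler_piMl ?exprn_ge0 ?ltW ?min_ratio_gt0 ?min_ratio_lt1.
  have := level_words_gt n0 uL; have := word_mapB S u 1 0.
  have /andP[+ _] := @word_map01 u 0 (introT andP (conj (lexx 0) ler01)).
  by rewrite aE; lra.
have [dn _ ltdc _] := dc; have ldc := net_interval_length n0 dc.
have /andP[d0 _] := net_points01 dn.
exists d; split => //; [by rewrite setU_itvcc// ltW| |lra].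
exact: le_trans (gapS n0) (net_points_gap n0 dn cn an ltdc ltca).
Qed.

Lemma net_interval0 a b : net_interval S 0 a b -> a = 0 /\ b = 1.
Proof. by move=> [[] -> [] -> + _]; rewrite ?ltxx// ltr10. Qed.

(** The only net interval of level 0 has no neighbours, so the doubling condition only concerns
    positive levels. *)
Lemma net_neighbour_level n a b D : net_interval S n a b ->
  net_left S n a D \/ net_right S n b D -> (0 < n)%N.
Proof.
case: n => // /net_interval0[-> ->] [] [c /net_interval0[]].
  by move=> _ /eqP; rewrite eq_sym oner_eq0.
by move=> /eqP; rewrite oner_eq0.
Qed.

Lemma gap_le n : (0 < n)%N -> gap n <= lam ^+ n.
Proof.
move=> n0; apply: le_trans (ltW (gap_lt n0)) _.
by rewrite exprS ler_piMl ?exprn_ge0 ?ltW ?min_ratio_gt0 ?min_ratio_lt1.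
Qed.

(** Doubling without the length condition on [a, b] and with a cost depending on [r] alone; [E] lies
    in [0, 1] within distance [r / 4] of one end of the interval. *)
Definition doubling_at_scale (C eps : R) : Prop :=
  forall n a b r E, (0 < n)%N -> net_interval S n a b ->
    0 < r <= gap n -> r <= 4 * (b - a) -> measurable E ->
    (b < 1 /\ (forall z, E z -> b <= z <= b + r / 4 /\ z <= 1)) \/
    (0 < a /\ (forall z, E z -> a - r / 4 <= z <= a /\ 0 <= z)) ->
    mass mu E <= C * r `^ (- eps) * mass mu `[a, b]%classic.

(* The level M at which [a, b] is last a net interval satisfies r <= 4 lam^M,
   so that the doubling constant q^M is a power of r. *)
Lemma quasi_net_doubling_at_scale eps : 0 < eps -> quasi_net_doubling S f mu ->
  exists2 C, 1 <= C & doubling_at_scale C eps.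
Proof.
have lam0 := min_ratio_gt0 S; have lam1 := min_ratio_lt1 S.
move=> eps0 dbl.
have q1 : 1 < lam `^ (- eps).
  rewrite powRN invf_gt1 ?powR_gt0// -(powRr0 lam) /powR gt_eqF//.
  by rewrite ltr_expR mul0r pmulr_rlt0// ln_lt0 ?lam0.
have [c1 [c2 [c10 c20 {}dbl]]] := dbl _ q1.
exists (Num.max 1 (c1^-1 * 4 `^ eps)); first by rewrite le_max lexx.
move=> n a b r E n0 nab /andP[r0 rn] rab mE ED.
have [M [nM Mab gapM Mn]] := net_interval_last n0 nab.
have M0 : (0 < M)%N := leq_trans n0 nM.
(* Hence [E] fits in the neighbour [D], which has length at least [gap M] or extends to the end of
   [0, 1]. *)
have rM : r / 4 <= gap M by case: Mn => [->|]; lra.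
have [an bn _ _] := Mab.
have [D [nD mD ED']] : exists D, [/\ net_left S M a D \/ net_right S M b D,
    measurable (D : set (measurableTypeR R)) & E `<=` D].
  case: ED => -[ab1 ED].
    have [d [nd dP]] := net_right_exists M0 bn ab1.
    exists `[b, d]%classic; split; [by right|by []|].
    by move=> z /ED[? ?]; rewrite /= in_itv/=; case: dP => [->|?]; lra.
  have [d [nd dP]] := net_left_exists M0 an ab1.
  exists `[d, a]%classic; split; [by left|by []|].
  by move=> z /ED[? ?]; rewrite /= in_itv/=; case: dP => [->|?]; lra.
have [+ _] := dbl _ _ _ _ Mab gapM nD.
rewrite !massE// -EFinM lee_fin => DM.
apply: le_trans (le_mass mu mE mD ED') _.
have qM : (lam `^ (- eps)) ^+ M <= 4 `^ eps * r `^ (- eps).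
  rewrite -powR_mulrn ?powR_ge0// -powRrM mulrC powRrM powR_mulrn ?(ltW lam0)//.
  have -> : 4 `^ eps * r `^ (- eps) = (r / 4) `^ (- eps).
    by rewrite powRM ?(ltW r0)// -powR_inv1// -powRrM mulN1r opprK mulrC.
  rewrite !powRN lef_pV2 ?posrE ?powR_gt0 ?exprn_gt0 ?divr_gt0//.
  apply: ge0_ler_powR; rewrite ?nnegrE ?exprn_ge0 ?(ltW eps0) ?(ltW lam0)//; first lra.
  exact: le_trans rM (gap_le M0).
have q0 : 0 < (lam `^ (- eps)) ^+ M by rewrite exprn_gt0// powR_gt0.
have {}DM : mass mu D <= c1^-1 * (lam `^ (- eps)) ^+ M * mass mu `[a, b]%classic.
  rewrite -ler_pdivrMl ?mulr_gt0 ?invr_gt0//.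
  by rewrite invfM invrK.
apply: le_trans DM _; rewrite ler_wpM2r ?mass_ge0//.
apply: (@le_trans _ _ (c1^-1 * 4 `^ eps * r `^ (- eps))).
  by rewrite -mulrA ler_wpM2l ?invr_ge0 ?(ltW c10).
by rewrite ler_wpM2r ?powR_ge0// le_max lexx orbT.
Qed.

Lemma ifs_map_eq j z : z = 0 \/ z = 1 ->
  forall y, 0 <= y <= 1 -> ifs_map S j y = z -> y = z.
Proof.
move=> z01 y /andP[y0 y1] yz.
have /andP[j0 _] := @ifs_map01 j 0 (introT andP (conj (lexx 0) ler01)).
have /andP[_ j1] := @ifs_map01 j 1 (introT andP (conj ler01 (lexx 1))).
have jr := ratio_gt0 S j.
apply/eqP; move: yz j0 j1; rewrite /ifs_map mulr0 mulr1 add0r.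
case: z01 => -> yz j0 j1.
  have : ratio S j * y <= 0 by lra.
  by rewrite pmulr_rle0// eq_le y0 andbT.
have : 0 <= ratio S j * (y - 1) by lra.
by rewrite pmulr_rge0// eq_le y1 subr_ge0.
Qed.

Lemma mass_endpoint0 : mass mu [set 0] = 0.
Proof.
apply: (@mass_endpoint _ ord_max) => [j|]; first by apply: ifs_map_eq; left.
move=> h; have := S_last; have := ratio_lt1 S ord_max; move: h; rewrite /ifs_map; lra.
Qed.

Lemma mass_endpoint1 : mass mu [set 1] = 0.
Proof.
apply: (@mass_endpoint _ ord0) => [j|]; first by apply: ifs_map_eq; right.
move=> h; have := S_first; have := ratio_lt1 S ord0; move: h; rewrite /ifs_map; lra.
Qed.

(** A piece that does not cover [a, b] meets it at most in one of its own endpoints, since no net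
    point lies strictly inside; its contribution is the mass of 0 or of 1, which vanishes. *)
Lemma net_interval_mass n a b W : (0 < n)%N -> net_interval S n a b ->
  decomposes W (level_words S n) ->
  mass mu `[a, b]%classic <=
    \sum_(u <- W | (word_map S u 0 <= a) && (b <= word_map S u 1)) word_prob u.
Proof.
move=> n0 [an bn ab nab] dW; apply: (mass_le_words dW) => // u uL ncov.
have un z : z = 0 \/ z = 1 -> ~ (a < word_map S u z < b).
  by move=> z01; apply: nab; apply/net_pointsE => //;
    case: z01 => ->; [left | right]; exists u.
have mE : measurable (`[a, b]%classic : set (measurableTypeR R)) by [].
apply/eqP; rewrite eq_le mass_ge0 andbT.
have [u0a|au0] := leP (word_map S u 0) a.
  have u1a : word_map S u 1 <= a.
    rewrite leNgt; apply/negP => au1; move: ncov; rewrite u0a/= -ltNge => u1b.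
    by apply: (un 1); [right | rewrite au1].
  rewrite -[leRHS]mass_endpoint1; apply: le_mass01 => //.
    exact: measurable_word_preimage.
  move=> z /andP[z0 z1] /=; rewrite in_itv/= => /andP[az _].
  apply/eqP; rewrite eq_le z1 -(word_map_le S u) (le_trans u1a)//.
have u0b : b <= word_map S u 0.
  by rewrite leNgt; apply/negP => u0b; apply: (un 0); [left | rewrite au0].
rewrite -[leRHS]mass_endpoint0; apply: le_mass01 => //.
  exact: measurable_word_preimage.
move=> z /andP[z0 z1] /=; rewrite in_itv/= => /andP[_ zb].
by apply/eqP; rewrite eq_le z0 -(word_map_le S u) (le_trans zb).
Qed.

(** * Comparison of two concentric balls *)

Section LocalComparison.
Variables (n : nat) (W : seq (seq 'I_m.+1)) (c s C eps x rho r : R).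
Hypothesis n0 : (0 < n)%N.
Hypothesis dW : decomposes W (level_words S n).
Hypothesis (c0 : 0 < c) (s0 : 0 < s) (C1 : 1 <= C) (eps0 : 0 < eps).
Hypothesis low : power_lower_bound c s.
Hypothesis dbl : doubling_at_scale C eps.
Hypothesis x01 : 0 <= x <= 1.
Hypothesis rho_gap : rho <= gap n.
Hypothesis r0 : 0 < r.
Hypothesis r_rho : r <= rho.

(** [g] bounds from below the share of a level [n] piece within [r / 16] of one of its points, a
    radius below all those used later; [G] bounds the cost of doubling at every scale from [r / 2]
    on. *)
Let g := c * (r / 16 / lam ^+ n) `^ s.
Let G := C * (r / 2) `^ (- eps).
Let Q (P : pred (seq 'I_m.+1)) := \sum_(u <- W | P u) word_prob u.
Let covers u := (word_map S u 0 <= x) && (x <= word_map S u 1).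

Let lamn0 : 0 < lam ^+ n.
Proof. by rewrite exprn_gt0// min_ratio_gt0. Qed.

Let rn : r <= lam ^+ n.
Proof. exact: le_trans r_rho (le_trans rho_gap (gap_le n0)). Qed.

Local Ltac scale_lra := move: r0 r_rho rho_gap rn; lra.

Let r1 : r <= 1.
Proof.
by apply: le_trans rn _; rewrite exprn_ile1 ?ltW ?min_ratio_gt0 ?min_ratio_lt1.
Qed.

Let Q_ge0 P : 0 <= Q P.
Proof. by apply: sumr_ge0 => u _; exact: word_prob_ge0. Qed.

Let le_Q (P P' : pred (seq 'I_m.+1)) :
  (forall u, level_words S n u -> P u -> P' u) -> Q P <= Q P'.
Proof.
move=> PP'; rewrite /Q big_mkcond [leRHS]big_mkcond big_seq [leRHS]big_seq.
apply: ler_sum => u uW; case: ifP => Pu; last by case: ifP; rewrite ?word_prob_ge0.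
by rewrite PP'//; case: dW => + _ _; move=> /(_ u)[+ _]; apply.
Qed.

Let g_gt0 : 0 < g.
Proof. by rewrite mulr_gt0 ?powR_gt0 ?divr_gt0. Qed.

Let le_g t : r / 16 <= t -> g <= c * (t / lam ^+ n) `^ s.
Proof.
move=> rt; rewrite ler_wpM2l ?(ltW c0)//.
have t0 : 0 < t by scale_lra.
apply: ge0_ler_powR;
  rewrite ?nnegrE ?divr_ge0 ?(ltW s0) ?(ltW lamn0) ?(ltW r0) ?(ltW t0)//.
by rewrite ler_pM2r ?invr_gt0.
Qed.

Let Q_le_mass (P : pred (seq 'I_m.+1)) t E : r / 16 <= t -> t <= r -> measurable E ->
  (forall u, level_words S n u -> P u -> exists2 y, 0 <= y <= 1 &
    forall z, 0 <= z <= 1 -> `|word_map S u z - word_map S u y| <= t ->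
      E (word_map S u z)) ->
  Q P * g <= mass mu E.
Proof.
move=> rt tr mE PE; have t0 : 0 < t <= lam ^+ n by scale_lra.
apply: le_trans (mass_ge_words n0 dW low t0 mE PE).
by rewrite ler_wpM2l// le_g.
Qed.

Let g_le1 : g <= 1.
Proof.
rewrite -[leRHS]mass01.
have rl : 0 < r / 16 / lam ^+ n <= 1.
  by rewrite divr_gt0 ?ler_pdivrMr// ?mul1r; scale_lra.
by apply: (low x01 rl) => // z z01 _; rewrite /= in_itv/=.
Qed.

Let G_ge1 : 1 <= G.
Proof.
rewrite /G -[leLHS]mulr1 ler_pM// powRN invf_ge1 ?powR_gt0 ?divr_gt0//.
have := @ge0_ler_powR R _ (ltW eps0) (r / 2) 1; rewrite powR1; apply.
- by rewrite nnegrE; scale_lra.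
- by rewrite nnegrE.
- by move: r1; lra.
Qed.

Let mball t : measurable (ball x t : set (measurableTypeR R)).
Proof. exact: measurable_ball. Qed.

Let Q_covers : Q covers * g <= mass mu (ball x r).
Proof.
apply: (@Q_le_mass _ (r / 2)) => //; try scale_lra.
move=> u uL /andP[u0 u1].
have ur := word_ratio_gt0 S u.
have uE := word_mapE S u.
exists ((x - word_map S u 0) / word_ratio S u).
  rewrite divr_ge0 ?subr_ge0 ?(ltW ur)//= ler_pdivrMr// mul1r.
  by move: u1; rewrite uE; lra.
move=> z z01; rewrite [X in _ - X]uE mulrC divfK ?gt_eqF// subrK => zx.
by rewrite /ball/= distrC; apply: le_lt_trans zx _; scale_lra.
Qed.

(** One factor [g] pays for passing from the words of [P] to [E], and doubling moves [E] into
    [a, b]. The words covering [a, b] also cover [x], and the second [g] brings their mass into the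
    small ball. *)
Let transfer (P : pred (seq 'I_m.+1)) a b E t : net_interval S n a b ->
  (forall u, level_words S n u -> word_map S u 0 <= a -> b <= word_map S u 1 ->
    covers u) ->
  Q P * g <= mass mu E -> r / 2 <= t ->
  mass mu E <= C * t `^ (- eps) * mass mu `[a, b]%classic ->
  Q P * g ^+ 2 <= G * mass mu (ball x r).
Proof.
move=> nab cov QE rt Eab.
have C0 : 0 <= C by apply: le_trans C1.
have tG : C * t `^ (- eps) <= G.
  rewrite ler_wpM2l// !powRN lef_pV2 ?posrE ?powR_gt0//; try by scale_lra.
  by apply: ge0_ler_powR; rewrite ?nnegrE ?(ltW eps0)//; scale_lra.
have G0 : 0 <= G by apply: le_trans G_ge1.
rewrite expr2 mulrA; apply: (@le_trans _ _ (G * Q covers * g)).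
  rewrite ler_wpM2r ?(ltW g_gt0)//; apply: le_trans QE (le_trans Eab _).
  apply: ler_pM => //; rewrite ?mass_ge0 ?mulr_ge0 ?powR_ge0//.
  apply: le_trans (net_interval_mass n0 nab dW) _.
  by apply: le_Q => u uL /andP[]; exact: cov.
by rewrite -mulrA ler_wpM2l// Q_covers.
Qed.

Let direct (P : pred (seq 'I_m.+1)) :
  Q P * g <= mass mu (ball x r) -> Q P * g ^+ 2 <= G * mass mu (ball x r).
Proof.
move=> QB; apply: (@le_trans _ _ (Q P * g)).
  rewrite expr2 mulrA; apply: ler_piMr => //.
  by apply: mulr_ge0 => //; exact: ltW.
by apply: le_trans QB _; rewrite ler_peMl ?mass_ge0.
Qed.

Let starts_right u := x < word_map S u 0 < x + rho.

(** With [a <= x < b <= e], where [e] is the common starting point, either [b, e] is long compared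
    with [r] and receives the mass, or [a, b] is long and receives it, or [e] is within [3 * r / 8]
    of [x] and [e, e + r/2] already lies in the small ball. *)
Let Q_starts_right : Q starts_right * g ^+ 2 <= G * mass mu (ball x r).
Proof.
have [[v [vL vx]]|none] :=
  pselect (exists v, level_words S n v /\ starts_right v); last first.
  have -> : Q starts_right = 0.
    apply/eqP; rewrite eq_le Q_ge0 andbT -(big_pred0_eq 0 +%R W word_prob).
    by apply: le_Q => u uL ux; exfalso; apply: none; exists u.
  by rewrite mul0r mulr_ge0 ?mass_ge0// (le_trans ler01)// G_ge1.
pose e := word_map S v 0; have {vx} /andP[xe er] : x < e < x + rho := vx.
have e0 : endpoint n 0 e by exists v.
have l0 : (0 : R) = 0 \/ (0 : R) = 1 by left.
have same u : level_words S n u -> starts_right u -> word_map S u 0 = e.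
  move=> uL /andP[ux ur].
  have u0 : endpoint n 0 (word_map S u 0) by exists u.
  apply/eqP; case: ltgtP => // ue.
    by have := endpoint_gap n0 l0 u0 e0 ue; scale_lra.
  by have := endpoint_gap n0 l0 e0 u0 ue; scale_lra.
have e1 : e < 1.
  have /andP[_] := @word_map01 v 1 (introT andP (conj ler01 (lexx 1))).
  by apply: lt_le_trans; rewrite word_map_lt.
have low_e t E : r / 16 <= t -> t <= r -> measurable E ->
    (forall z, 0 <= z <= 1 -> e <= z <= e + t -> E z) ->
    Q starts_right * g <= mass mu E.
  move=> rt tr mE eE; apply: (Q_le_mass rt tr mE) => u uL ux.
  exists 0; first by rewrite lexx ler01.
  move=> z z01; rewrite (same u uL ux) => zt; apply: eE; first exact: word_map01.
  have : e <= word_map S u z by rewrite -(same u uL ux) word_map_le; case/andP: z01.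
  by move: zt; rewrite ler_norml; lra.
have [|a [b [nab ax xb]]] := @net_interval_right n x n0.
  by case/andP: x01 => -> _; exact: lt_trans xe e1.
have [an bn ltab noab] := nab.
have en : net_points S n e by apply/net_pointsE => //; left.
have be : b <= e.
  rewrite leNgt; apply/negP => eb; apply: (noab e en).
  by rewrite eb andbT (le_lt_trans ax).
have [rbe|ber] := ltP r (8 * (e - b)).
  have ltbe : b < e by scale_lra.
  (* A net point between [b] and [e] would give [gap n <= e - b], whereas [e - b < rho <= gap n]. *)
  have nbe : net_interval S n b e.
    split => // h hn /andP[bh he].
    by have := net_points_gap n0 bn hn en bh he; scale_lra.
  pose E : set (measurableTypeR R) := `[e, e + r / 8] `&` `[0, 1].
  have mE : measurable E by exact: measurableI.
  apply: (transfer (E := E) (t := r / 2) nbe) => //.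
  (* A word covering [b, e] cannot start at [b], which is too close to [e] for two images of 0, nor
     inside (a, b); so it starts at or before [a], hence covers [x]. *)
  - move=> u uL ub eu; rewrite /covers (le_trans (ltW xe) eu) andbT.
    move: ub; rewrite le_eqVlt => /predU1P[ub|ub].
      have b0 : endpoint n 0 b by exists u.
      by have := endpoint_gap n0 l0 b0 e0 ltbe; scale_lra.
    apply: le_trans ax; rewrite leNgt; apply/negP => au.
    apply: (noab (word_map S u 0)); last by rewrite au.
    by apply/net_pointsE => //; left; exists u.
  - apply: (low_e (r / 8)) => //; try by scale_lra.
  - apply: (dbl n0 nbe) => //; try by scale_lra.
    left; split => // z [/=]; rewrite !in_itv/= => /andP[? ?] /andP[? ?].
    by split; lra.
have [ab4|ab4] := leP r (4 * (b - a)).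
  pose E : set (measurableTypeR R) := `[b, b + r / 4] `&` `[0, 1].
  have mE : measurable E by exact: measurableI.
  apply: (transfer (E := E) (t := r) nab) => //; last 2 first.
  - by scale_lra.
  - apply: (dbl n0 nab) => //; try by scale_lra.
    left; split; first exact: le_lt_trans be e1.
    move=> z [/=]; rewrite !in_itv/= => /andP[? ?] /andP[? ?].
    by split; lra.
  - by move=> u uL ua bu; rewrite /covers (le_trans ua ax) (le_trans (ltW xb) bu).
  - apply: (low_e (r / 8)) => //; try by scale_lra.
    by move=> z z01 ez; split; rewrite /= in_itv/=; lra.
apply: direct; apply: (low_e (r / 2)) => //; try by scale_lra.
by move=> z z01 ez; rewrite /ball/= ltr_norml; scale_lra.
Qed.

Let ends_left u := x - rho < word_map S u 1 < x.

(** Mirror image of the previous argument, with images of 1 and a net interval satisfying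
    [e <= a < x <= b]. *)
Let Q_ends_left : Q ends_left * g ^+ 2 <= G * mass mu (ball x r).
Proof.
have [[v [vL vx]]|none] :=
  pselect (exists v, level_words S n v /\ ends_left v); last first.
  have -> : Q ends_left = 0.
    apply/eqP; rewrite eq_le Q_ge0 andbT -(big_pred0_eq 0 +%R W word_prob).
    by apply: le_Q => u uL ux; exfalso; apply: none; exists u.
  by rewrite mul0r mulr_ge0 ?mass_ge0// (le_trans ler01)// G_ge1.
pose e := word_map S v 1; have {vx} /andP[er ex] : x - rho < e < x := vx.
have e1 : endpoint n 1 e by exists v.
have l1 : (1 : R) = 0 \/ (1 : R) = 1 by right.
have same u : level_words S n u -> ends_left u -> word_map S u 1 = e.
  move=> uL /andP[ur ux].
  have u1 : endpoint n 1 (word_map S u 1) by exists u.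
  apply/eqP; case: ltgtP => // ue.
    by have := endpoint_gap n0 l1 u1 e1 ue; scale_lra.
  by have := endpoint_gap n0 l1 e1 u1 ue; scale_lra.
have e0 : 0 < e.
  have /andP[+ _] := @word_map01 v 0 (introT andP (conj (lexx 0) ler01)).
  by move=> /le_lt_trans; apply; rewrite word_map_lt.
have low_e t E : r / 16 <= t -> t <= r -> measurable E ->
    (forall z, 0 <= z <= 1 -> e - t <= z <= e -> E z) ->
    Q ends_left * g <= mass mu E.
  move=> rt tr mE eE; apply: (Q_le_mass rt tr mE) => u uL ux.
  exists 1; first by rewrite lexx ler01.
  move=> z z01; rewrite (same u uL ux) => zt; apply: eE; first exact: word_map01.
  have : word_map S u z <= e by rewrite -(same u uL ux) word_map_le; case/andP: z01.
  by move: zt; rewrite ler_norml; lra.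
have [|a [b [nab ax xb]]] := @net_interval_left n x n0.
  by case/andP: x01 => _ ->; rewrite andbT; exact: lt_trans e0 ex.
have [an bn ltab noab] := nab.
have en : net_points S n e by apply/net_pointsE => //; right.
have ea : e <= a.
  by rewrite leNgt; apply/negP => ae; apply: (noab e en); rewrite ae (lt_le_trans ex).
have [rea|ear] := ltP r (8 * (a - e)).
  have ltea : e < a by scale_lra.
  have nea : net_interval S n e a.
    split => // h hn /andP[eh ha].
    by have := net_points_gap n0 en hn an eh ha; scale_lra.
  pose E : set (measurableTypeR R) := `[e - r / 8, e] `&` `[0, 1].
  have mE : measurable E by exact: measurableI.
  apply: (transfer (E := E) (t := r / 2) nea) => //.
  - move=> u uL ue au; rewrite /covers (le_trans ue (ltW ex))/=.
    move: au; rewrite le_eqVlt => /predU1P[au|au].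
      have a1 : endpoint n 1 a by exists u.
      by have := endpoint_gap n0 l1 e1 a1 ltea; scale_lra.
    apply: (le_trans xb); rewrite leNgt; apply/negP => ub.
    apply: (noab (word_map S u 1)); last by rewrite au.
    by apply/net_pointsE => //; right; exists u.
  - by apply: (low_e (r / 8)) => //; scale_lra.
  - apply: (dbl n0 nea) => //; try by scale_lra.
    right; split => // z [/=]; rewrite !in_itv/= => /andP[? ?] /andP[? ?].
    by split; lra.
have [ab4|ab4] := leP r (4 * (b - a)).
  pose E : set (measurableTypeR R) := `[a - r / 4, a] `&` `[0, 1].
  have mE : measurable E by exact: measurableI.
  apply: (transfer (E := E) (t := r) nab) => //; last 2 first.
  - by scale_lra.
  - apply: (dbl n0 nab) => //; try by scale_lra.
    right; split; first exact: lt_le_trans e0 ea.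
    move=> z [/=]; rewrite !in_itv/= => /andP[? ?] /andP[? ?].
    by split; lra.
  - by move=> u uL ua bu; rewrite /covers (le_trans ua (ltW ax)) (le_trans xb bu).
  - apply: (low_e (r / 8)) => //; try by scale_lra.
    by move=> z z01 ez; split; rewrite /= in_itv/=; lra.
apply: direct; apply: (low_e (r / 2)) => //; try by scale_lra.
by move=> z z01 ez; rewrite /ball/= ltr_norml; scale_lra.
Qed.

(** A piece charging the large ball contains [x], starts just right of it or ends just left of it;
    the factor 3 counts these families. *)
Lemma mass_ball_compare :
  mass mu (ball x rho) * (c * (r / 16 / lam ^+ n) `^ s) ^+ 2 <=
    3 * (C * (r / 2) `^ (- eps)) * mass mu (ball x r).
Proof.
rewrite -/g -/G.
have mrho : mass mu (ball x rho) <= Q covers + Q starts_right + Q ends_left.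
  pose P u := [|| covers u, starts_right u | ends_left u].
  apply: (@le_trans _ _ (Q P)).
    apply: (mass_le_words dW) => // u uL; rewrite !negb_or => /and3P[nc nr nl].
    apply/eqP; rewrite eq_le mass_ge0 andbT.
    have -> : 0 = mass mu set0 by rewrite /mass measure0.
    apply: le_mass01 => //; first exact: measurable_word_preimage.
    move=> z /andP[z0 z1]; rewrite /ball/= ltr_norml => /andP[zr zl].
    have u0z : word_map S u 0 <= word_map S u z by rewrite word_map_le.
    have uz1 : word_map S u z <= word_map S u 1 by rewrite word_map_le.
    move: nc; rewrite negb_and -!ltNge => /orP[xu|ux].
      by case/negP: nr; rewrite /starts_right xu; lra.
    by case/negP: nl; rewrite /ends_left ux andbT; lra.
  have QE P' : Q P' = \sum_(u <- W) (if P' u then word_prob u else 0).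
    by rewrite /Q big_mkcond.
  rewrite !QE -!big_split/=; apply: ler_sum => u _.
  by rewrite /P; have := word_prob_ge0 u;
    case: (covers u); case: (starts_right u); case: (ends_left u) => /=; lra.
apply: (@le_trans _ _ ((Q covers + Q starts_right + Q ends_left) * g ^+ 2)).
  by rewrite ler_wpM2r// exprn_ge0// ltW.
rewrite !mulrDl; move: Q_starts_right Q_ends_left (direct Q_covers).
lra.
Qed.

End LocalComparison.

(** * From net doubling to a finite exponent *)

Lemma gap_subexponential eps : 0 < eps -> exists2 K, 1 <= K &
  forall n, (0 < n)%N -> (f n)^-1 <= K * (lam ^+ n) `^ (- eps).
Proof.
move=> eps0; case: agwscS => f0 fle flim _.
have lam0 := min_ratio_gt0 S; have lam1 := min_ratio_lt1 S.
have lnlam : ln lam < 0 by rewrite ln_lt0 ?lam0.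
have el0 : 0 < eps * - ln lam by rewrite mulr_gt0 ?oppr_gt0.
have /cvgrPdist_lt/(_ _ el0)[k _ kP] := flim.
(* Beyond [k] the limit gives the bound with constant 1; up to [k] monotonicity of [f] bounds the
   inverse by its value at [k.+1]. *)
exists (Num.max 1 (f k.+1)^-1); first by rewrite le_max lexx.
move=> n n0.
have powE : (lam ^+ n) `^ (- eps) = expR (n%:R * (eps * - ln lam)).
  rewrite /powR gt_eqF ?exprn_gt0// lnXn// -[ln lam *+ n]mulr_natl.
  by congr expR; ring.
have [nk|kn] := leqP n k.
  apply: (@le_trans _ _ (f k.+1)^-1).
    by rewrite lef_pV2 ?posrE ?f0//; apply: fle => //; exact: ltnW.
  rewrite -[leLHS]mulr1 ler_pM ?ler01 ?invr_ge0 ?(ltW (f0 _ _))//.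
    by rewrite le_max lexx orbT.
  by rewrite powE -expR0 ler_expR mulr_ge0// ltW.
rewrite -[leLHS]mul1r ler_pM ?invr_ge0 ?(ltW (f0 _ _))//.
  by rewrite le_max lexx.
have := kP n (ltnW kn); rewrite /= sub0r normrN ltr_norml => /andP[+ _].
have n0' : 0 < n%:R :> R by rewrite ltr0n.
rewrite ltr_pdivlMr// => fn.
rewrite powE -[f n]lnK ?posrE ?f0// -expRN ler_expR.
by rewrite mulrC; move: fn; rewrite mulNr; lra.
Qed.

Lemma level_of_scale rho : 0 < rho <= gap 1 ->
  exists n, [/\ (0 < n)%N, rho <= gap n & gap n.+1 < rho].
Proof.
move=> /andP[rho0 rho1].
have lam0 := min_ratio_gt0 S; have lam1 := min_ratio_lt1 S.
have ex : exists k, gap k.+1 < rho.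
  have /cvgrPdist_lt /(_ _ rho0) [k _ kP] : lam ^+ n @[n --> \oo] --> (0 : R).
    by apply: cvg_expr; rewrite gtr0_norm.
  exists k; have := kP k (leqnn k).
  rewrite /= sub0r normrN ger0_norm ?exprn_ge0 ?(ltW lam0)//; apply: le_lt_trans.
  apply: le_trans (gap_le (ltn0Sn k)) _.
  by rewrite ler_wiXn2l ?(ltW lam0) ?(ltW lam1).
move: (ex_minnP ex) => [[|k] kr kmin]; first by rewrite ltNge rho1 in kr.
exists k.+1; split => //; rewrite leNgt; apply/negP => /kmin.
by rewrite ltnn.
Qed.

Lemma quasi_net_doubling_exponent : quasi_net_doubling S f mu ->
  exists s, forall delta, 0 < delta -> qA_exponent mu delta s.
Proof.
move=> dbl; have [c [s [c0 s0 low]]] := mass_lower.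
have lam0 := min_ratio_gt0 S; have lam1 := min_ratio_lt1 S.
(* The term [2 * s] comes from the square in the ball comparison; the extra 1 absorbs all negative
   powers of [r]. *)
exists (2 * s + 1) => delta delta0.
pose eps := delta / (1 + delta) / (1 + 2 * s).
have eps0 : 0 < eps by rewrite !divr_gt0// addr_gt0// mulr_gt0.
have [C C1 Cdbl] := quasi_net_doubling_at_scale eps0 dbl.
have [K K1 KP] := gap_subexponential eps0.
have C0 : 0 < C := lt_le_trans ltr01 C1.
have K0 : 0 < K := lt_le_trans ltr01 K1.
pose K' := 16 * (K * lam^-1 * lam `^ (- eps)).
have K'0 : 0 < K' by rewrite !mulr_gt0 ?invr_gt0 ?powR_gt0.
pose C2 := 3 * (C * 2 `^ eps) / c ^+ 2 * K' `^ (2 * s).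
have C20 : 0 < C2 by rewrite !mulr_gt0 ?invr_gt0 ?powR_gt0 ?exprn_gt0.
exists (gap 1), C2; split => //; first exact: gap_gt0.
move=> r rho r0 rho0 r_rho rho_rho rho1.
have {rho_rho} r_le := le_trans r_rho rho_rho.
apply: ub_ereal_sup => _ [x + <-]; rewrite mu_support /= in_itv/= => x01.
have [|n [n0 rhon nrho]] := @level_of_scale rho; first by rewrite rho0.
have [W dW] := level_enum n0.
have cmp := mass_ball_compare n0 dW c0 s0 C1 eps0 low Cdbl x01 rhon r0 r_le.
have B0 : 0 < mass mu (ball x r).
  have xs : measure_support mu x by rewrite mu_support /= in_itv.
  by have := xs r r0; rewrite massE ?lte_fin//; exact: measurable_ball.
rewrite -/(mass mu _) -/(mass mu (ball x r)) lee_fin ler_pdivrMr//.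
have lamn0 : 0 < lam ^+ n by rewrite exprn_gt0.
pose X := rho / r.
have X0 : 0 < X by rewrite divr_gt0.
have rX : r `^ (- (eps * (1 + 2 * s))) <= X.
  have d1 : 0 < 1 + delta by lra.
  have -> : eps * (1 + 2 * s) = delta / (1 + delta).
    by rewrite /eps divfK// gt_eqF// addr_gt0// mulr_gt0.
  have -> : - (delta / (1 + delta)) = (1 + delta)^-1 - 1.
    by field; rewrite gt_eqF.
  have -> : r `^ ((1 + delta)^-1 - 1) = r `^ (1 + delta)^-1 / r.
    by rewrite powRB ?(gt_eqF r0) ?implybT// (powRr1 (ltW r0)).
  rewrite ler_pM2r ?invr_gt0//.
  have -> : rho = (rho `^ (1 + delta)) `^ (1 + delta)^-1.
    by rewrite -powRrM divff ?gt_eqF// powRr1// ltW.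
  by apply: ge0_ler_powR; rewrite ?nnegrE ?invr_ge0 ?powR_ge0 ?(ltW r0) ?(ltW d1).
have lamX : (r / 16 / lam ^+ n)^-1 <= K' * X * r `^ (- eps).
  (* The level was chosen with [gap n.+1 < rho], so [lam ^+ n.+1] is below [rho / f n.+1], and
     [lam ^+ n.+1 >= lam * r] turns the subexponential bound into a power of [r]. *)
  have lamS : lam ^+ n.+1 <= rho * (K * (lam `^ (- eps) * r `^ (- eps))).
    have fn0 : 0 < f n.+1 by case: agwscS => + _ _ _; apply.
    apply: (@le_trans _ _ (rho * (f n.+1)^-1)).
      by rewrite ler_pdivlMr// mulrC ltW.
    rewrite ler_wpM2l ?(ltW rho0)//; apply: le_trans (KP _ (ltn0Sn n)) _.
    rewrite ler_wpM2l ?(ltW K0)// -powRM ?(ltW lam0) ?(ltW r0)//.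
    rewrite !powRN lef_pV2 ?posrE ?powR_gt0 ?mulr_gt0 ?exprn_gt0//.
    apply: ge0_ler_powR; rewrite ?nnegrE ?(ltW eps0) ?exprn_ge0 ?(ltW lam0)//.
      by rewrite mulr_ge0 ?ltW.
    rewrite exprS ler_wpM2l ?(ltW lam0)//.
    exact: le_trans r_le (le_trans rhon (gap_le n0)).
  have -> : (r / 16 / lam ^+ n)^-1 = 16 * (lam^-1 * lam ^+ n.+1) / r.
    rewrite exprS mulKf ?gt_eqF//.
    by field; rewrite !gt_eqF.
  rewrite /K' /X; have -> : 16 * (K / lam * lam `^ (- eps)) * (rho / r) * r `^ (- eps) =
      16 * (lam^-1 * (rho * (K * (lam `^ (- eps) * r `^ (- eps))))) / r.
    by ring.
  by rewrite ler_pM2r ?invr_gt0// ler_pM2l// ler_pM2l ?invr_gt0.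
set A := r / 16 / lam ^+ n in cmp lamX.
have A0 : 0 < A by rewrite !divr_gt0.
have AE : (c * A `^ s) ^+ 2 = c ^+ 2 / (A^-1) `^ (2 * s).
  have -> : (A^-1) `^ (2 * s) = (A `^ (2 * s))^-1.
    by rewrite -(powR_inv1 (ltW A0)) -powRrM mulN1r powRN.
  by rewrite exprMn invrK -[(A `^ s) ^+ 2]powR_mulrn ?powR_ge0// -powRrM [s * _]mulrC.
have Ainv : (A^-1) `^ (2 * s) <=
    K' `^ (2 * s) * X `^ (2 * s) * r `^ (- (eps * (2 * s))).
  rewrite -mulNr (powRrM r) -(powRM _ (ltW K'0) (ltW X0)).
  rewrite -(powRM _ (ltW (mulr_gt0 K'0 X0)) (powR_ge0 _ _)).
  apply: ge0_ler_powR => //; rewrite ?nnegrE ?invr_ge0 ?(ltW A0)//.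
    by rewrite mulr_ge0// ltW.
  by apply: mulr_ge0; [exact: (ltW (mulr_gt0 K'0 X0)) | exact: powR_ge0].
have AV0 : 0 < (A^-1) `^ (2 * s) by apply: powR_gt0; rewrite invr_gt0.
have {cmp} cmp : mass mu (ball x rho) <=
    3 * (C * (r / 2) `^ (- eps)) / c ^+ 2 * (A^-1) `^ (2 * s) * mass mu (ball x r).
  move: cmp; rewrite AE mulrA ler_pdivrMr// -ler_pdivlMr ?exprn_gt0// => cmp.
  by apply: le_trans cmp _; rewrite le_eqVlt; apply/orP; left; apply/eqP; ring.
apply: le_trans cmp _; rewrite ler_wpM2r ?mass_ge0//.
have -> : C2 * X `^ (2 * s + 1) = 3 * (C * 2 `^ eps) / c ^+ 2 *
    (K' `^ (2 * s) * X `^ (2 * s) * X).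
  by rewrite powRD ?(gt_eqF X0) ?implybT// (powRr1 (ltW X0)) /C2; ring.
have -> : (r / 2) `^ (- eps) = 2 `^ eps * r `^ (- eps).
  by rewrite powRM ?(ltW r0)// -powR_inv1// -powRrM mulN1r opprK mulrC.
have D0 : 0 <= 3 * (C * 2 `^ eps) / c ^+ 2.
  by rewrite !mulr_ge0 ?powR_ge0 ?invr_ge0 ?exprn_ge0 ?ltW.
have -> : 3 * (C * (2 `^ eps * r `^ (- eps))) / c ^+ 2 * A^-1 `^ (2 * s) =
   3 * (C * 2 `^ eps) / c ^+ 2 * (A^-1 `^ (2 * s) * r `^ (- eps)) by ring.
rewrite ler_wpM2l//.
apply: le_trans (ler_wpM2r (powR_ge0 _ _) Ainv) _.
rewrite -[leLHS]mulrA -powRD ?(gt_eqF r0) ?implybT//.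
have -> : - (eps * (2 * s)) - eps = - (eps * (1 + 2 * s)) by ring.
by rewrite ler_wpM2l// mulr_ge0 ?powR_ge0.
Qed.

(** * From a finite exponent to net doubling *)

Lemma exponent_mass_le s q : (forall delta, 0 < delta -> qA_exponent mu delta s) ->
  0 < s -> 1 < q ->
  exists2 K, 0 < K & forall n x A B, (0 < n)%N -> 0 <= x <= 1 ->
    measurable A -> measurable B ->
    (forall z, 0 <= z <= 1 -> A z -> `|z - x| < 4 * lam ^+ n) ->
    (forall z, 0 <= z <= 1 -> `|z - x| <= gap n.+1 / 2 -> B z) ->
    mass mu A <= K * q ^+ n * mass mu B.
Proof.
move=> exs s0 q1.
have lam0 := min_ratio_gt0 S; have lam1 := min_ratio_lt1 S.
have q0 : 0 < q by lra.
have lnlam : ln lam < 0 by rewrite ln_lt0 ?lam0.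
pose eps := ln q / - ln lam / s.
have eps0 : 0 < eps by rewrite !divr_gt0 ?ln_gt0 ?oppr_gt0.
have qE n : (lam ^+ n) `^ (- eps * s) = q ^+ n.
  rewrite mulNr /eps divfK ?gt_eqF// -powR_mulrn ?(ltW lam0)// -powRrM mulrC powRrM.
  rewrite powR_mulrn ?powR_ge0//; congr (_ ^+ _).
  by rewrite invrN mulrN opprK /powR gt_eqF// divfK ?lt_eqF// lnK ?posrE.
have [C1 [C2 [C10 C20 dimP]]] := exs _ eps0.
have [K K1 KP] := gap_subexponential eps0.
have K0 : 0 < K := lt_le_trans ltr01 K1.
have [c [t [c0 t0 low]]] := mass_lower.
have min0 : 0 < Num.min C1 1 / 4 by rewrite divr_gt0// lt_min C10 ltr01.
(* The exponent only controls radii up to [C1]. The levels below [k] are finitely many, and there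
   [eta] bounds the mass of [B] from below. *)
have [k kP] : exists k, forall n, (k <= n)%N ->
    4 * lam ^+ n <= C1 /\ 4 * lam ^+ n <= 1.
  have /cvgrPdist_lt /(_ _ min0) [k _ kP] : lam ^+ n @[n --> \oo] --> (0 : R).
    by apply: cvg_expr; rewrite gtr0_norm.
  exists k => n /kP; rewrite /= sub0r normrN ger0_norm ?exprn_ge0 ?(ltW lam0)//.
  by rewrite ltr_pdivlMr// lt_min => /andP[? ?]; split; lra.
pose eta := c * (gap k.+1 / 2) `^ t.
have eta0 : 0 < eta by rewrite mulr_gt0 ?powR_gt0 ?divr_gt0 ?gap_gt0.
pose L := C2 * Num.max 1 (8 * (K * lam^-1 * lam `^ (- eps))) `^ s.
have L0 : 0 < L by rewrite mulr_gt0 ?powR_gt0// lt_max ltr01.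
exists (Num.max eta^-1 L); first by rewrite lt_max L0 orbT.
move=> n x A B n0 x01 mA mB Ax xB.
have g0 : 0 < gap n.+1 by rewrite gap_gt0.
have lamn0 : 0 < lam ^+ n by rewrite exprn_gt0.
have [nk|kn] := ltnP n k.
  have gk : gap k.+1 <= gap n.+1.
    have : (n <= k)%N by exact: ltnW.
    elim: k {kP eta eta0 L L0 nk} => [|k IH]; first by case: (n) n0.
    rewrite leq_eqVlt => /predU1P[->//|]; rewrite ltnS => /IH.
    exact/le_trans/gapS.
  have g1 : gap n.+1 <= 1.
    apply: le_trans (gap_le (ltn0Sn n)) _.
    by rewrite exprn_ile1 ?(ltW lam0) ?(ltW lam1).
  have etaB : eta <= mass mu B.
    apply: le_trans (low x (gap n.+1 / 2) B x01 _ mB xB); last by lra.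
    rewrite ler_wpM2l ?(ltW c0)//; apply: ge0_ler_powR; rewrite ?nnegrE ?(ltW t0)//.
    - by rewrite divr_ge0 ?(ltW (gap_gt0 _)).
    - by rewrite divr_ge0 ?(ltW g0).
    - by rewrite ler_pM2r.
  apply: le_trans (mass_le1 mu mA) _.
  apply: (@le_trans _ _ (eta^-1 * 1 * eta)); first by rewrite mulr1 mulVf ?gt_eqF.
  apply: ler_pM => //; rewrite ?mulr1 ?invr_ge0 ?(ltW eta0)//.
  rewrite -[leLHS]mulr1; apply: ler_pM; rewrite ?invr_ge0 ?(ltW eta0)//.
    by rewrite le_max lexx.
  by rewrite exprn_ege1// ltW.
pose rho := 4 * lam ^+ n.
have rho0 : 0 < rho by rewrite mulr_gt0.
have [rhoC rho1] := kP n kn.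
pose r := Num.min (gap n.+1 / 2) (rho `^ (1 + eps)).
have r0 : 0 < r by rewrite lt_min divr_gt0//= powR_gt0.
have rho_rho : rho `^ (1 + eps) <= rho.
  by apply: ge1r_powR; [rewrite rho0 | lra].
have xs : measure_support mu x by rewrite mu_support /= in_itv.
have Br0 : 0 < mass mu (ball x r).
  by have := xs r r0; rewrite massE ?lte_fin//; exact: measurable_ball.
have := dimP r rho r0 rho0 _ rho_rho rhoC.
rewrite ge_min lexx orbT => /(_ isT) sup_le.
have {sup_le} : ((mass mu (ball x rho) / mass mu (ball x r))%:E <=
    (C2 * (rho / r) `^ s)%:E)%E.
  by apply: le_trans sup_le; apply: ereal_sup_ubound; exists x.
rewrite lee_fin ler_pdivrMr// => cmp.
have mAr : mass mu A <= mass mu (ball x rho).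
  apply: le_mass01 => //; first exact: measurable_ball.
  by move=> z z01 /Ax zx; rewrite /ball/= distrC; exact: zx.
have mBr : mass mu (ball x r) <= mass mu B.
  apply: le_mass01 => //; first exact: measurable_ball.
  move=> z z01; rewrite /ball/= distrC => zx; apply: xB => //.
  by apply: le_trans (ltW zx) _; rewrite ge_min lexx.
apply: le_trans mAr (le_trans cmp _); apply: ler_pM => //; rewrite ?mass_ge0//.
  by rewrite mulr_ge0 ?powR_ge0// ltW.
apply: (@le_trans _ _ (L * q ^+ n)); last first.
  by rewrite ler_wpM2r ?exprn_ge0 ?(ltW q0)// le_max lexx orbT.
rewrite /L -[leRHS]mulrA ler_wpM2l ?(ltW C20)// -qE (powRrM (lam ^+ n)).
have M0 : 0 <= Num.max 1 (8 * (K * lam^-1 * lam `^ (- eps))) by rewrite le_max ler01.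
rewrite -powRM ?powR_ge0//.
apply: ge0_ler_powR; rewrite ?nnegrE; first exact: ltW.
- by apply: divr_ge0; exact: ltW.
- by apply: mulr_ge0 => //; exact: powR_ge0.
rewrite ler_pdivrMr// mulrAC.
set M := Num.max _ _; have [M1 MK] : 1 <= M /\ 8 * (K * lam^-1 * lam `^ (- eps)) <= M.
  by rewrite !le_max !lexx orbT.
have pow0 : 0 < (lam ^+ n) `^ (- eps) by rewrite powR_gt0.
rewrite /r; case: (leP (gap n.+1 / 2)) => _.
  have f0 : 0 < f n.+1 by case: agwscS => + _ _ _; apply.
  have fK : 1 <= K * (lam `^ (- eps) * (lam ^+ n) `^ (- eps)) * f n.+1.
    rewrite -ler_pdivrMr// mul1r -powRM ?exprn_ge0 ?(ltW lam0)// -exprS.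
    exact: KP.
  apply: (@le_trans _ _ (8 * (K * lam^-1 * lam `^ (- eps)) * (gap n.+1 / 2) *
    (lam ^+ n) `^ (- eps))).
    have -> : 8 * (K * lam^-1 * lam `^ (- eps)) * (gap n.+1 / 2) *
        (lam ^+ n) `^ (- eps) =
        4 * lam ^+ n * (K * (lam `^ (- eps) * (lam ^+ n) `^ (- eps)) * f n.+1).
      by rewrite /gap exprS; field; rewrite gt_eqF.
    by rewrite ler_peMr// ltW.
  rewrite ler_wpM2r ?(ltW pow0)// ler_wpM2r//.
  by rewrite divr_ge0 ?(ltW g0).
apply: (@le_trans _ _ (rho `^ (1 + eps) * (lam ^+ n) `^ (- eps))).
  rewrite powRD ?(gt_eqF rho0) ?implybT// (powRr1 (ltW rho0)) -mulrA.
  rewrite ler_peMr ?(ltW rho0)//.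
  rewrite powRN -[leLHS](divff (lt0r_neq0 (powR_gt0 eps lamn0))).
  rewrite ler_pM2r ?invr_gt0 ?powR_gt0//.
  apply: ge0_ler_powR; rewrite ?nnegrE ?(ltW eps0) ?(ltW lamn0) ?(ltW rho0)//.
  by rewrite /rho; lra.
by rewrite ler_wpM2r ?(ltW pow0)// ler_peMl ?powR_ge0.
Qed.

(** The interval and its neighbour are adjacent, of lengths between [gap n.+1] and [2 * lam ^+ n],
    so each lies within [4 * lam ^+ n] of the midpoint of the other; the previous bound applies in
    both directions. *)
Lemma exponent_quasi_net_doubling s :
  (forall delta, 0 < delta -> qA_exponent mu delta s) -> 0 < s ->
  quasi_net_doubling S f mu.
Proof.
move=> exs s0 q q1; have q0 : 0 < q by lra.
have [K K0 KP] := exponent_mass_le exs s0 q1.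
exists K^-1, K; split => //; first by rewrite invr_gt0.
move=> n a b D nab long nD.
have n0 := net_neighbour_level nab nD.
have lab := net_interval_length n0 nab.
have [an bn _ _] := nab.
have /andP[a0 _] := net_points01 an; have /andP[_ b1] := net_points01 bn.
have lamn0 : 0 < lam ^+ n by rewrite exprn_gt0// min_ratio_gt0.
have g0 : 0 < gap n.+1 by rewrite gap_gt0.
rewrite -/(gap n.+1) in long.
have [c [d [[DE c0 d1 gcd lcd] near]]] : exists c d, [/\ D = `[c, d]%classic,
    0 <= c, d <= 1, gap n.+1 <= d - c & d - c <= 2 * lam ^+ n] /\ (d = a \/ c = b).
  case: nD => [/(net_left_shape n0)|/(net_right_shape n0)] [d [? ? ? ? ?]].
    by exists d, a; split; [split | left].
  by exists b, d; split; [split | right].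
have mab : measurable (`[a, b]%classic : set (measurableTypeR R)) by [].
have mD : measurable (D : set (measurableTypeR R)) by rewrite DE.
rewrite !massE// -!EFinM !lee_fin; split.
  rewrite -invfM ler_pdivrMl ?mulr_gt0 ?exprn_gt0//.
  apply: (KP n ((a + b) / 2)) => //; first lra.
    by move=> z _; rewrite DE /= in_itv/= ltr_norml; lra.
  by move=> z _; rewrite /= in_itv/= ler_norml; lra.
apply: (KP n ((c + d) / 2)) => //; first lra.
  by move=> z _; rewrite /= in_itv/= ltr_norml; lra.
by move=> z _; rewrite DE /= in_itv/= ler_norml; lra.
Qed.

End NetIntervals.
End SelfSimilar.

(** * Finiteness of the dimension in terms of a uniform exponent *)

Section Dimension.
Context {R : realType} (mu : probability (measurableTypeR R) R).

Lemma qA_exponent_le_delta delta delta' s : 0 < delta -> delta <= delta' ->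
  qA_exponent mu delta s -> qA_exponent mu delta' s.
Proof.
move=> delta0 dd [C1 [C2 [C10 C20 P]]]; exists C1, C2; split => // r rho r0 rho0.
move=> r_rho rho_rho rhoC.
have rho1 : rho <= 1.
  rewrite leNgt; apply/negP => rho1; move: rho_rho.
  rewrite -[leRHS](powRr1 (ltW rho0)) leNgt /powR gt_eqF// ltr_expR mul1r.
  by rewrite ltr_pMl ?ln_gt0//; lra.
apply: P => //.
  by apply: le_trans r_rho _; apply: ger_powR; [rewrite rho0 | lra].
by apply: ge1r_powR; [rewrite rho0 | lra].
Qed.

Lemma qA_exponent_le delta s s' : s <= s' ->
  qA_exponent mu delta s -> qA_exponent mu delta s'.
Proof.
move=> ss [C1 [C2 [C10 C20 P]]]; exists C1, C2; split => //.
move=> r rho r0 rho0 r_rho rho_rho rhoC.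
apply: le_trans (P r rho r0 rho0 r_rho rho_rho rhoC) _.
rewrite lee_fin ler_pM2l//; apply: ler_powR => //.
by rewrite ler_pdivlMr// mul1r; exact: le_trans rho_rho.
Qed.

(** By monotonicity the limit at 0 from the right is a supremum over all positive [delta], so one
    real number strictly above it is an admissible exponent for every [delta]. *)
Lemma qA_dim_lt_pinfty : (qA_dim mu < +oo)%E <->
  exists s, forall delta, 0 < delta -> qA_exponent mu delta s.
Proof.
have H_ni : {in Interval (BRight 0) (BInfty R false) &, nonincreasing_fun (qA_H mu)}.
  move=> d d' /=; rewrite !in_itv/= !andbT => d0 d'0 dd.
  by apply: le_ereal_inf => _ [s sP <-]; exists s => //; exact: qA_exponent_le_delta sP.
have H_cvg := nonincreasing_at_right_cvge (BInfty R false) isT H_ni.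
have dimE : qA_dim mu =
    ereal_sup (qA_H mu @` [set` Interval (BRight 0) (BInfty R false)]).
  by apply/cvg_lim.
rewrite dimE; split=> [dim_fin|[s sP]].
  have [s dim_s] : exists s : R,
      (ereal_sup (qA_H mu @` [set` Interval (BRight 0%R) (BInfty R false)]) < s%:E)%E.
    case: ereal_sup dim_fin => [d _||] //; last by exists 0%R; rewrite ltNyr.
    by exists (d + 1)%R; rewrite lte_fin ltrDl.
  exists s => delta delta0.
  have : (qA_H mu delta < s%:E)%E.
    apply: le_lt_trans dim_s; apply: ereal_sup_ubound.
    by exists delta => //=; rewrite in_itv/= delta0.
  move=> /ereal_inf_lt[_ [s' s'P <-]]; rewrite lte_fin => /ltW ss.
  exact: qA_exponent_le s'P.
apply: (@le_lt_trans _ _ s%:E); last exact: ltry.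
apply: ub_ereal_sup => _ [d + <-]; rewrite /= in_itv/= andbT => d0.
by apply: ereal_inf_lbound; exists s => //; exact: sP.
Qed.

End Dimension.

Theorem theorem4p4 (R : realType) (m : nat) (S : ifs R m.+1)
    (p : 'I_m.+1 -> R) (mu : probability (measurableTypeR R) R)
    (f : nat -> R)
    (attractorS : is_attractor S `[0, 1])
    (S_first : ifs_map S ord0 0 = 0) (S_last : ifs_map S ord_max 1 = 1)
    (p_gt0 : forall j, 0 < p j) (p_sum1 : \sum_(j < m.+1) p j = 1)
    (mu_self_similar : self_similar S p mu)
    (mu_support : measure_support mu = `[0, 1]%classic)
    (agwscS : agwsc S f)
    (f_lt : forall n, (0 < n)%N -> f n < min_ratio S) :
  (qA_dim mu < +oo)%E <-> quasi_net_doubling S f mu.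
Proof.
rewrite qA_dim_lt_pinfty; split=> [[s sP]|dbl].
  (* Raising the exponent to at least 1 keeps it admissible and makes it positive. *)
  apply: (exponent_quasi_net_doubling attractorS p_gt0 p_sum1 mu_self_similar
    mu_support S_first S_last agwscS f_lt (s := Num.max s 1)).
    by move=> delta delta0; apply: qA_exponent_le (sP _ delta0); rewrite le_max lexx.
  by rewrite lt_max ltr01 orbT.
exact: (quasi_net_doubling_exponent attractorS p_gt0 p_sum1 mu_self_similar
    mu_support S_first S_last agwscS f_lt dbl).
Qed.
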